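(* Consider a simulation transition model $\mathcal P_\theta(s'\mid s,a)$, a simulation reward function $R_\theta(s,a)$, and the resulting in-simulation policy $\pi_\phi(a\mid s)$ obtained by solving the in-simulation reinforcement learning problem using the stochastic policy gradient $$\hat\varphi(\phi,\theta)=\mathbb E_{s\sim\hat\rho_\theta^{\pi_\phi}}\big[\nabla_\phi\log\pi_\phi(a\mid s)\,Q_\theta^{\pi_\phi}(s,a)\big]$$ in an actor-critic setting. Assume that $\pi_\phi$, $\mathcal P_\theta$ and $R_\theta$ are continuously differentiable with respect to their respective parameters $\phi$ and $\theta$. Assume that the policy parameters $\phi$ correspond to a locally stationary solution of the stochastic policy gradient update, i.e. $\hat\varphi(\phi,\theta)=0$; that $\hat\varphi$ is continuously differentiable in $(\phi,\theta)$; that the stationary solution $\phi$ is locally isolated; and that the Jacobian $\nabla_\phi\hat\varphi(\phi,\theta)$ is nonsingular. Then the sensitivity of the in-simulation policy parameters $\phi$ with respect to the simulation model and reward parameters $\theta$ is given by $$\nabla_\theta\phi=-\Big(\mathbb E_{s\sim\hat\rho_\theta^{\pi_\phi}}\big[\nabla_{\phi\phi}\log\pi_\phi\,Q_\theta^{\pi_\phi}+\nabla_\phi\log\pi_\phi\,\nabla_\phi Q_\theta^{\pi_\phi}\big]+D_\phi\Big)^{-1}\Big(\mathbb E_{s\sim\hat\rho_\theta^{\pi_\phi}}\big[\nabla_\phi\log\pi_\phi\,\nabla_\theta Q_\theta^{\pi_\phi}\big]+D_\theta\Big),$$ where $D_\phi$ and $D_\theta$ denote the gradients, with respect to $\phi$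 and $\theta$ respectively, of the expectation $\mathbb E_{s\sim\hat\rho_\theta^{\pi_\phi}}[\nabla_\phi\log\pi_\phi\,Q_\theta^{\pi_\phi}]$ through the sampling distribution only (integrand held fixed).
   Context: Parameters are $\theta\in\mathbb R^{d_\theta}$ and $\phi\in\mathbb R^{d_\phi}$; $\gamma\in(0,1)$ is a discount factor. $Q_\theta^{\pi_\phi}(s,a)=\mathbb E[\sum_{t\ge0}\gamma^tR_\theta(s_t,a_t)\mid s_0=s,a_0=a]$ is the action-value function (critic) of $\pi_\phi$ in simulation, where $s_{t+1}\sim\mathcal P_\theta(\cdot\mid s_t,a_t)$ and, for $t\ge1$, $a_t\sim\pi_\phi(\cdot\mid s_t)$. $\hat\rho_\theta^{\pi_\phi}$ is the discounted state density of the Markov chain generated by $\pi_\phi$ and $\mathcal P_\theta$ from a fixed initial state distribution. All expectations $\mathbb E_{s\sim\hat\rho_\theta^{\pi_\phi}}[\cdot]$ are over $s\sim\hat\rho_\theta^{\pi_\phi}$ and $a\sim\pi_\phi(\cdot\mid s)$, with $\log\pi_\phi=\log\pi_\phi(a\mid s)$ and $Q_\theta^{\pi_\phi}=Q_\theta^{\pi_\phi}(s,a)$. Here $\phi$ is regarded as the function of $\theta$ defined locally by $\hat\varphi(\phi,\theta)=0$ (implicit function theorem). Products of gradients denote outer products, so $(\nabla_\phi\log\pi_\phi\,\nabla_\phi Q)_{ij}=\partial_{\phi_i}\log\pi_\phi\,\partial_{\phi_j}Q$ and $(\nabla_\phi\log\pi_\phi\,\nabla_\theta Q)_{ij}=\partial_{\phi_i}\log\pi_\phi\,\partial_{\theta_j}Q$;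 $\nabla_{\phi\phi}\log\pi_\phi$ is the Hessian in $\phi$; $\nabla_\phi\hat\varphi$ and $\nabla_\theta\phi$ are Jacobian matrices. $\nabla_\theta Q_\theta^{\pi_\phi}$ is the derivative of the critic under a fixed policy, $\nabla_\phi Q_\theta^{\pi_\phi}$ its derivative under fixed model and reward. Distributional gradients: $D_\phi=\nabla_{\phi'}\,\mathbb E_{s\sim\hat\rho_\theta^{\pi_{\phi'}},\,a\sim\pi_{\phi'}}[\nabla_\phi\log\pi_\phi(a\mid s)\,Q_\theta^{\pi_\phi}(s,a)]\big|_{\phi'=\phi}$ (effect of changing $\phi$ on the distribution, with model and reward fixed) and $D_\theta=\nabla_{\theta'}\,\mathbb E_{s\sim\hat\rho_{\theta'}^{\pi_\phi},\,a\sim\pi_\phi}[\nabla_\phi\log\pi_\phi(a\mid s)\,Q_\theta^{\pi_\phi}(s,a)]\big|_{\theta'=\theta}$ (effect of changing $\theta$ on the distribution, with the policy fixed).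
   Formalization: Added: near the base point log π is twice differentiable in φ, Q is differentiable in φ and in θ, and one function with finite expectation, continuous in the parameters, bounds the integrand and its φ- and θ-derivatives. Without such a bound the formula can fail. *)

(* Defs.v *)
From HB Require Import structures.
From mathcomp Require Import all_boot all_order all_algebra.
From mathcomp Require Import all_classical all_reals all_analysis.

Set Implicit Arguments.
Unset Strict Implicit.
Unset Printing Implicit Defensive.
Set SsrOldRewriteGoalsOrder.

Import Order.TTheory GRing.Theory Num.Theory.
Import numFieldNormedType.Exports.

Local Open Scope classical_set_scope.
Local Open Scope ring_scope.

Section calculus.
Context {R : realType}.

(* In finite dimension, continuity of x |-> 'd f x is continuity of all the
   directional derivatives.  The second conjunct is only meaningful where f is
   differentiable on a neighbourhood; the predicate is always used for all x,
   or for all x near some point. *)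
Definition continuously_differentiable {V W : normedModType R}
    (f : V -> W) (x : V) : Prop :=
  differentiable f x /\ forall v, {for x, continuous (fun y => 'D_v f y)}.

Definition grad {p} (f : 'rV[R]_p -> R) (x : 'rV[R]_p) : 'rV[R]_p :=
  \row_j 'D_(delta_mx 0 j) f x.

Definition hess {p} (f : 'rV[R]_p -> R) (x : 'rV[R]_p) : 'M[R]_p :=
  \matrix_(i, j) 'D_(delta_mx 0 j) (fun y => grad f y 0 i) x.

(* The library's [jacobian] acts on row vectors by right multiplication: its
   (i, j) entry is the derivative of the j-th component along the i-th
   coordinate.  The usual Jacobian matrix is its transpose. *)
Definition jac {p q} (f : 'rV[R]_p -> 'rV[R]_q) (x : 'rV[R]_p) : 'M[R]_(q, p) :=
  (jacobian f x)^T.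

Definition outer {p q} (u : 'rV[R]_p) (v : 'rV[R]_q) : 'M[R]_(p, q) :=
  u^T *m v.

(* g is the function of y defined near y0 by the equation f x y = 0, with
   x near x0. *)
Definition defined_implicitly {p q} (f : 'rV[R]_p -> 'rV[R]_q -> 'rV[R]_p)
    (x0 : 'rV[R]_p) (y0 : 'rV[R]_q) (g : 'rV[R]_q -> 'rV[R]_p) : Prop :=
  g y0 = x0 /\ \forall y \near y0 & x \near x0, f x y = 0 <-> x = g y.

Definition mexpect {d} {T : measurableType d} (mu : {measure set T -> \bar R})
    {p q} (F : T -> 'M[R]_(p, q)) : 'M[R]_(p, q) :=
  \matrix_(i, j) \int[mu]_x F x i j.

End calculus.

(* The law of (x, y) for x drawn from mu and then y from k x. *)
Section semidirect.
Context {R : realType} {d d' : measure_display} {X : measurableType d}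
  {Y : measurableType d'}.
Variables (mu : {measure set X -> \bar R}) (k : R.-pker X ~> Y).

Definition semidirect (B : set (X * Y)) : \bar R :=
  (\int[mu]_x k x (xsection B x))%E.

Let semidirect0 : semidirect set0 = 0%E.
Proof.
by rewrite /semidirect integral0_eq// => x _; rewrite xsection0 measure0.
Qed.

Let semidirect_ge0 B : (0 <= semidirect B)%E.
Proof. exact: integral_ge0. Qed.

Let semidirect_sigma_additive : semi_sigma_additive semidirect.
Proof.
move=> F mF tF mUF.
rewrite [X in _ --> X](_ : _ = \sum_(n <oo) semidirect (F n))%E.
  by apply: is_cvg_ereal_nneg_natsum => n _; exact: semidirect_ge0.
rewrite /semidirect -integral_nneseries//; last first.
  move=> n; apply: measurable_fun_xsection_finite_kernel.
  by rewrite inE; exact: mF.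
apply: eq_integral => x _; rewrite xsection_bigcup.
rewrite measure_semi_bigcup//.
- by move=> n; exact: measurable_xsection.
- exact: trivIset_xsection.
- by apply: bigcup_measurable => n _; exact: measurable_xsection.
Qed.

HB.instance Definition _ := isMeasure.Build _ _ _ semidirect
  semidirect0 semidirect_ge0 semidirect_sigma_additive.

End semidirect.

(* Under P, X is a Markov chain with initial law mu and transition kernel K. *)
Definition is_markov_chain {R : realType} {d d' : measure_display}
    {W : measurableType d} {T : measurableType d'} (P : set W -> \bar R)
    (X : nat -> W -> T) (mu : set T -> \bar R) (K : T -> set T -> \bar R) :
    Prop :=
  (forall B, measurable B -> P (X 0%N @^-1` B) = mu B) /\
  forall n (C : nat -> set T) (B : set T),
    (forall i, measurable (C i)) -> measurable B ->
    let past := \bigcap_(i < n.+1) (X i @^-1` C i) in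
    P (past `&` X n.+1 @^-1` B) = (\int[P]_(w in past) K (X n w) B)%E.

(* A parametrized discounted decision process: policy parameters in 'rV_m,
   model and reward parameters in 'rV_n, states S, actions A, and a space W of
   trajectories on which [step t] is the pair (s_t, a_t).  Policies and
   transitions have densities with respect to fixed reference measures on A and
   S (counting measures in the discrete case), so that pointwise derivatives
   in the parameters make sense. *)
Record simulation (R : realType) (dS dA dW : measure_display)
    (S : measurableType dS) (A : measurableType dA) (W : measurableType dW)
    (m n : nat) := Simulation {
  discount : R ;
  discount_gt0 : 0 < discount ;
  discount_lt1 : discount < 1 ;
  init : probability S R ;
  actm : {measure set A -> \bar R} ;
  statem : {measure set S -> \bar R} ;
  pol_dens : 'rV[R]_m -> S * A -> R ;
  pol_dens_ge0 : forall phi z, 0 <= pol_dens phi z ;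
  pol_dens_meas : forall phi, measurable_fun setT (pol_dens phi) ;
  policy : 'rV[R]_m -> R.-pker S ~> A ;
  policyE : forall phi s B, measurable B ->
    policy phi s B = (\int[actm]_(a in B) (pol_dens phi (s, a))%:E)%E ;
  trans_dens : 'rV[R]_n -> S * A -> S -> R ;
  trans_dens_ge0 : forall th z s', 0 <= trans_dens th z s' ;
  trans_dens_meas : forall th,
    measurable_fun setT (fun zs : (S * A) * S => trans_dens th zs.1 zs.2) ;
  trans : 'rV[R]_n -> R.-pker (S * A) ~> S ;
  transE : forall th z B, measurable B ->
    trans th z B = (\int[statem]_(s' in B) (trans_dens th z s')%:E)%E ;
  reward : 'rV[R]_n -> S * A -> R ;
  reward_meas : forall th, measurable_fun setT (reward th) ;
  step : nat -> {mfun W >-> (S * A)%type} ;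
  (* law of the trajectory started at s_0 = z.1, a_0 = z.2 *)
  traj : 'rV[R]_m -> 'rV[R]_n -> R.-pker (S * A) ~> W ;
  trajP : forall phi th z,
    is_markov_chain (traj phi th z) step \d_z
      (fun z' => semidirect (trans th z') (policy phi)) }.

Section quantities.
Context {R : realType} {dS dA dW : measure_display} {S : measurableType dS}
  {A : measurableType dA} {W : measurableType dW} {m n : nat}.
Variable M : simulation R S A W m n.
Implicit Types (phi : 'rV[R]_m) (th : 'rV[R]_n) (z : S * A).

(* [ln] is 0 at 0, but a continuous density with differentiable logpi near phi
   vanishes at z throughout a neighbourhood of phi or nowhere in it; such z are
   null for all the policies concerned, so positivity need not be assumed. *)
Definition logpi z phi : R := ln (pol_dens M phi z).

Definition critic phi th z : R :=
  fine (\int[traj M phi th z]_w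
    \sum_(t <oo) (discount M ^+ t * reward M th (step M t w))%:E)%E.

(* law of s_t when s_0 is drawn from init and a_0 from the policy *)
Definition state_law phi th (t : nat) (B : set S) : \bar R :=
  (\int[semidirect (init M) (policy M phi)]_z
     traj M phi th z [set w | B (step M t w).1])%E.

(* Normalized to total mass 1, so that it is the law of a random state. *)
Definition discounted_state phi th (B : set S) : \bar R :=
  ((1 - discount M)%:E *
     \sum_(t <oo) (discount M ^+ t)%:E * state_law phi th t B)%E.

Section measures.
Variables (phi : 'rV[R]_m) (th : 'rV[R]_n).

Let measurable_hit t (B : set S) : measurable B ->
  measurable [set w | B (step M t w).1].
Proof.
move=> mB; have : measurable_fun setT (fst \o step M t : W -> S).
  exact: measurableT_comp.
by move=> /(_ measurableT _ mB); rewrite setTI.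
Qed.

Section state_law_measure.
Variable t : nat.

Let state_law0 : state_law phi th t set0 = 0%E.
Proof.
rewrite /state_law integral0_eq// => z _.
by rewrite [X in traj _ _ _ _ X](_ : _ = set0) ?measure0.
Qed.

Let state_law_ge0 B : (0 <= state_law phi th t B)%E.
Proof. exact: integral_ge0. Qed.

Let state_law_sigma_additive : semi_sigma_additive (state_law phi th t).
Proof.
move=> F mF tF mUF.
rewrite [X in _ --> X](_ : _ = \sum_(i <oo) state_law phi th t (F i))%E.
  by apply: is_cvg_ereal_nneg_natsum => i _; exact: state_law_ge0.
rewrite /state_law -integral_nneseries//; last first.
  by move=> i; apply: measurable_kernel; exact: measurable_hit.
apply: eq_integral => z _.
rewrite [X in traj _ _ _ _ X](_ : _ =
  \bigcup_i [set w | F i (step M t w).1])// measure_semi_bigcup//.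
- by move=> i; exact: measurable_hit.
- apply/trivIsetP => i j _ _ ij; apply/seteqP; split=> // w [Fi Fj].
  move/trivIsetP : tF => /(_ i j Logic.I Logic.I ij)/seteqP[+ _].
  by apply; split; [exact: Fi|exact: Fj].
- by apply: bigcup_measurable => i _; exact: measurable_hit.
Qed.

HB.instance Definition _ := isMeasure.Build _ _ _ (state_law phi th t)
  state_law0 state_law_ge0 state_law_sigma_additive.

End state_law_measure.

Let discountX_ge0 t : 0 <= discount M ^+ t.
Proof. by rewrite exprn_ge0// ltW// discount_gt0. Qed.

Let discountB_ge0 : 0 <= 1 - discount M.
Proof. by rewrite subr_ge0 ltW// discount_lt1. Qed.

Let rho := mscale (NngNum discountB_ge0)
  (mseries (fun t => mscale (NngNum (discountX_ge0 t)) (state_law phi th t)) 0).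

Let discounted_state0 : discounted_state phi th set0 = 0%E.
Proof. exact: (measure0 rho). Qed.

Let discounted_state_ge0 B : (0 <= discounted_state phi th B)%E.
Proof. exact: (measure_ge0 rho). Qed.

Let discounted_state_sigma_additive :
  semi_sigma_additive (discounted_state phi th).
Proof. exact: (@measure_semi_sigma_additive _ _ _ rho). Qed.

HB.instance Definition _ := isMeasure.Build _ _ _ (discounted_state phi th)
  discounted_state0 discounted_state_ge0 discounted_state_sigma_additive.

End measures.

(* law of (s, a) for s drawn from the discounted state density and a from the
   policy *)
Definition sampling phi th : {measure set (S * A) -> \bar R} :=
  semidirect (discounted_state phi th) (policy M phi).

Definition score z phi : 'rV[R]_m := grad (logpi z) phi.

Definition phihat phi th : 'rV[R]_m :=
  mexpect (sampling phi th) (fun z => critic phi th z *: score z phi).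

Definition Dphi phi th : 'M[R]_m :=
  jac (fun phi' => mexpect (sampling phi' th)
                     (fun z => critic phi th z *: score z phi)) phi.

Definition Dtheta phi th : 'M[R]_(m, n) :=
  jac (fun th' => mexpect (sampling phi th')
                    (fun z => critic phi th z *: score z phi)) th.

(* derivatives, in phi and in theta, of the integrand of phihat *)
Definition integrand_dphi phi th z : 'M[R]_m :=
  critic phi th z *: hess (logpi z) phi +
  outer (score z phi) (grad (fun phi' => critic phi' th z) phi).

Definition integrand_dtheta phi th z : 'M[R]_(m, n) :=
  outer (score z phi) (grad (fun th' => critic phi th' z) th).

(* w dominates near (phi, th), uniformly in (s, a), the integrand of phihat
   and its two derivatives, and is integrable with an expectation that varies
   continuously with the sampling law.  Constants qualify, so this holds as
   soon as these three functions are bounded near (phi, th). *)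
Definition envelope phi th (w : S * A -> R) : Prop :=
  [/\ measurable_fun setT w,
      \forall phi' \near phi, forall z,
        `|critic phi' th z *: score z phi'| <= w z /\
        `|integrand_dphi phi' th z| <= w z,
      \forall th' \near th, forall z,
        `|critic phi th' z *: score z phi| <= w z /\
        `|integrand_dtheta phi th' z| <= w z,
      \forall phi' \near phi & th' \near th,
        (sampling phi' th').-integrable setT (EFin \o w)
    & {for (phi, th), continuous
        (fun p : 'rV[R]_m * 'rV[R]_n => \int[sampling p.1 p.2]_z w z)} ].

End quantities.

(* Main.v *)
(* Write phihat(phi, th) = F(phi, phi) with F(a, b) the expectation of the
   integrand at b under the sampling law at a.  The joint map F need not be
   differentiable, so the chain rule is replaced by the following argument.
   The one-step densities are continuous in the parameters, hence by Scheffe the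
   one-step laws, then the laws of (s_t, a_t) by induction on t, and finally the
   discounted sampling law, are continuous in total variation.  Together with
   the convergence of the expectation of the envelope this gives a dominated
   convergence theorem along moving measures, which differentiates
   F(phi, phi) - F(phi, phi0) at phi0.  Since phihat is differentiable, so is
   F(., phi0), and the Jacobian of phihat splits into the expected derivative of
   the integrand plus the distributional gradient; likewise in th.  The implicit
   function theorem (contraction mapping for existence, strict differentiability
   for the derivative) then yields the formula. *)
Require Import Defs.
From HB Require Import structures.
From mathcomp Require Import all_boot all_order all_algebra.
From mathcomp Require Import all_classical all_reals all_analysis.
From mathcomp Require Import measurable_realfun.
From mathcomp Require Import ring lra.

Set Implicit Arguments.
Unset Strict Implicit.
Unset Printing Implicit Defensive.

Import Order.TTheory GRing.Theory Num.Theory.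
Import numFieldNormedType.Exports.

Local Open Scope classical_set_scope.
Local Open Scope ring_scope.

(** * Differential calculus *)

(* Creates the missing join of the complete and normed structures on matrices. *)
HB.instance Definition _ (R : realType) m n := Complete.on 'M[R]_(m, n).

(** The integrands are merely measurable in (s, a), and the functions to be integrated are
    difference quotients that change with the parameter. Weak convergence of the sampling laws would
    therefore not do: the convergence has to be uniform over measurable test functions, and the test
    function must be free to move together with the law. On the other hand no derivative of the law
    is ever estimated. In F(phi, phi) - F(phi, phi0) both terms are taken under the same law, so the
    small factor phi - phi0 comes from the integrand alone and continuity of the law is enough. How
    the law itself varies to first order enters only through F(., phi0), which is reached by
    subtraction. Dominated convergence is sequential, so laws are compared along sequences of
    parameters, and the estimates are turned back into statements about neighbourhoods
    afterwards. *)

Section calculus_lemmas.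
Context {R : realType}.

(** Restriction to the segment reduces this to the mean value theorem in one real variable, so only
    derivability in the direction [v] is involved. *)
Lemma mean_value_bound {V : normedModType R} (f : V -> R) (a v : V) (C : R) :
  (forall t : R, t \in `[0, 1]%R ->
     derivable f (a + t *: v) v /\ `|'D_v f (a + t *: v)| <= C) ->
  `|f (a + v) - f a| <= C.
Proof.
move=> fC; pose g (t : R) := f (a + t *: v).
have quot t h : h^-1 *: (g (h + t) - g t) =
    h^-1 *: (f (h *: v + (a + t *: v)) - f (a + t *: v)).
  by rewrite /g scalerDl addrCA.
have quotE t : (fun h => h^-1 *: ((g \o shift t) (h *: 1) - g t)) =
    (fun h => h^-1 *: ((f \o shift (a + t *: v)) (h *: v) - f (a + t *: v))).
  by apply/funext => h; rewrite /= [h *: 1]mulr1 quot.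
have dg (t : R) : t \in `[0, 1]%R -> is_derive t 1 g ('D_v f (a + t *: v)).
  move=> /fC[dfv _]; split; first by rewrite /derivable quotE.
  by rewrite /derive quotE.
have cg : {within `[0, 1], continuous g}.
  apply: derivable_within_continuous => t /dg[] //.
have dg' (t : R) : t \in `]0, 1[%R -> is_derive t 1 g ('D_v f (a + t *: v)).
  by move=> /subset_itv_oo_cc; exact: dg.
have [c c01] := MVT_segment (@ler01 R) dg' cg.
rewrite /g scale1r scale0r addr0 subr0 mulr1 => ->.
by have [] := fC c c01.
Qed.

Lemma row_norm_le {m} (x : 'rV[R]_m) (C : R) : 0 <= C ->
  (forall i, `|x 0 i| <= C) -> `|x| <= C.
Proof.
move=> C0 xC; rewrite /Num.Def.normr/= mx_normrE bigmax_le// => -[i j] _ /=.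
by rewrite ord1.
Qed.

Lemma mx_entry_norm {m n} (A : 'M[R]_(m, n)) i j : `|A i j| <= `|A|.
Proof.
rewrite [leRHS]/Num.Def.normr/= mx_normrE.
exact: (le_bigmax _ (fun k : 'I_m * 'I_n => `|A k.1 k.2|) (i, j)).
Qed.

Lemma row_mulmx_bound {m n} (B : 'M[R]_(m, n)) :
  exists2 C, 0 < C & forall v : 'rV_m, `|v *m B| <= C * `|v|.
Proof.
(* The norm is the largest entry, and each entry of [v *m B] is a sum of [m] products. The [+ 1]
   keeps the constant positive when [B = 0] or [m = 0]. *)
exists (\sum_(k < m) `|B| + 1).
  by rewrite ltr_wpDl// sumr_ge0.
move=> v; apply: row_norm_le.
  by rewrite mulr_ge0// addr_ge0// sumr_ge0.
move=> i; rewrite mxE (le_trans (ler_norm_sum _ _ _))//.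
rewrite mulrDl mul1r ler_wpDr// mulr_suml ler_sum// => k _.
by rewrite normrM mulrC ler_pM// mx_entry_norm.
Qed.

Lemma mulmxr_continuous {m n} (B : 'M[R]_(m, n)) :
  continuous (mulmxr B : 'rV_m -> 'rV_n).
Proof.
apply/linear_bounded_continuous/linear_boundedP.
have [C C0 BC] := row_mulmx_bound B.
near=> r => v; rewrite (le_trans (BC v))// ler_wpM2r//.
Unshelve. all: by end_near. Qed.

Lemma diff_estimate {V W : normedModType R} (f : V -> W) (x : V) :
  differentiable f x ->
  forall e : R, 0 < e -> \forall y \near x,
    `|f y - f x - 'd f x (y - x)| <= e * `|y - x|.
Proof.
move=> /diff_locallyP[_ /eqaddoP fo] e e0.
rewrite (near_shift (0 : V) x) subr0; apply: filterS (fo _ e0) => h /=.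
rewrite !fctE /= addrK => H; apply: le_trans H.
by rewrite opprD addrA.
Qed.

(** Converse of [diff_estimate], by uniqueness of the differential. The derivatives of the implicit
    function and of the moving expectation are obtained from it. *)
Lemma estimate_diff {V W : normedModType R} (f : V -> W) (x : V)
    (df : {linear V -> W}) : continuous df ->
  (forall e : R, 0 < e -> \forall y \near x,
    `|f y - f x - df (y - x)| <= e * `|y - x|) ->
  differentiable f x /\ 'd f x = df :> (V -> W).
Proof.
move=> cdf fe.
have fo : f \o shift x = cst (f x) + df +o_ 0 id.
  apply/eqaddoP => e e0; have := fe e e0.
  rewrite (near_shift (0 : V) x) subr0; apply: filterS => h /=.
  by rewrite !fctE /= addrK => H; apply: le_trans H; rewrite opprD addrA.
have E := diff_unique cdf fo; split => //.
by apply/diff_locallyP; rewrite E.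
Qed.

Lemma derive_entry {V : normedModType R} {m n} (f : V -> 'M[R]_(m, n)) x v i j :
  derivable f x v ->
  derivable (fun y => f y i j) x v /\
  'D_v (fun y => f y i j) x = ('D_v f x) i j.
Proof.
move=> fxv; split; first by move/derivable_mxP : fxv.
by rewrite [in RHS]derive_mx// mxE.
Qed.

(** The mean value bound is applied to each coordinate of [f - 'd f p] on the segment from [a] to
    [b]; its derivative at [x] is ['d f x - 'd f p], which is uniformly small near [p]. *)
Lemma strict_diff {V : normedModType R} {m} (f : V -> 'rV[R]_m) (p : V) :
  (\forall x \near p, differentiable f x) ->
  (forall e : R, 0 < e ->
     \forall x \near p, forall v, `|'d f x v - 'd f p v| <= e * `|v|) ->
  forall e : R, 0 < e -> exists2 r : R, 0 < r &
    forall a b, ball p r a -> ball p r b ->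
      `|f b - f a - 'd f p (b - a)| <= e * `|b - a|.
Proof.
move=> df dfe e e0; have : \forall x \near p, differentiable f x /\
    (forall v, `|'d f x v - 'd f p v| <= e * `|v|).
  by apply: filterI => //; exact: dfe.
move=> /nbhs_ballP[r /= r0 pr]; exists r => // a b pa pb.
have dfp := (pr _ (ballxx p r0)).1.
apply: row_norm_le => [|i]; first by rewrite mulr_ge0// ltW.
pose g x := f x 0 i - 'd f p x 0 i.
have -> : (f b - f a - 'd f p (b - a)) 0 i = g (a + (b - a)) - g a.
  rewrite /g !(addrC a) !subrK linearB !mxE.
  by ring.
apply: mean_value_bound => t t01.
have pt : ball p r (a + t *: (b - a)).
  rewrite -ball_normE /ball_ /= in pa pb *.
  have -> : p - (a + t *: (b - a)) = (1 - t) *: (p - a) + t *: (p - b).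
    have -> : b - a = (p - a) - (p - b) by rewrite opprB [RHS]addrC subrKA.
    by rewrite opprD addrA scalerBr opprB addrA addrAC scalerBl scale1r.
  move: t01; rewrite in_itv /= => /andP[t0 t1].
  rewrite (le_lt_trans (ler_normD _ _))// !normrZ ger0_norm ?subr_ge0//.
  rewrite (ger0_norm t0); set u := `|p - a| in pa *; set v := `|p - b| in pb *.
  (* Strictness comes from the first summand, which disappears at [t = 1]; there the point is [b]
     itself. *)
  have [->|tn1] := eqVneq t 1; first by rewrite subrr mul0r add0r mul1r.
  have : (1 - t) * u < (1 - t) * r by rewrite ltr_pM2l// subr_gt0 lt_neqAle tn1.
  have : t * v <= t * r by rewrite ler_wpM2l// ltW.
  lra.
have [dft dfet] := pr _ pt; set x := a + t *: (b - a) in dft dfet *.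
have D1 : derivable f x (b - a) by exact: diff_derivable.
have cdfp : continuous ('d f p) by exact: diff_continuous.
have D2 : derivable ('d f p : V -> 'rV_m) x (b - a).
  exact/diff_derivable/linear_differentiable.
have D2E : 'D_(b - a) ('d f p : V -> 'rV_m) x = 'd f p (b - a).
  by rewrite deriveE ?diff_lin//; exact: linear_differentiable.
have [D1i D1iE] := derive_entry 0 i D1.
have [D2i D2iE] := derive_entry 0 i D2.
split; first exact: derivableB.
rewrite deriveB// D1iE D2iE D2E deriveE//.
apply: le_trans (dfet (b - a)).
by apply: le_trans (mx_entry_norm _ 0 i); rewrite !mxE.
Qed.

Lemma linear_pair_sum {p q} {W : lmodType R}
    (g : {linear ('rV[R]_p * 'rV[R]_q)%type -> W}) u w :
  g (u, w) = \sum_j u 0 j *: g (delta_mx 0 j, 0)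
             + \sum_j w 0 j *: g (0, delta_mx 0 j).
Proof.
have -> : (u, w) = (u, 0) + (0, w) :> 'rV[R]_p * 'rV[R]_q.
  by congr pair; rewrite ?addr0 ?add0r.
rewrite linearD; congr (_ + _).
  rewrite [in LHS](row_sum_delta u).
  have -> : (\sum_j u 0 j *: delta_mx 0 j, 0) =
      \sum_j u 0 j *: (delta_mx 0 j, 0) :> 'rV[R]_p * 'rV[R]_q.
    elim/big_ind2 : _ => // [[a b] c [a' b'] c' [<- <-] [<- <-]|j _].
      by congr pair; rewrite ?addr0.
    by congr pair; rewrite scaler0.
  by rewrite linear_sum; apply: eq_bigr => j _; rewrite linearZ.
rewrite [in LHS](row_sum_delta w).
have -> : (0, \sum_j w 0 j *: delta_mx 0 j) =
    \sum_j w 0 j *: (0, delta_mx 0 j) :> 'rV[R]_p * 'rV[R]_q.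
  elim/big_ind2 : _ => // [[a b] c [a' b'] c' [<- <-] [<- <-]|j _].
    by congr pair; rewrite ?addr0.
  by congr pair; rewrite scaler0.
by rewrite linear_sum; apply: eq_bigr => j _; rewrite linearZ.
Qed.

(** A linear map is controlled by its values on the [p + q] basis vectors, so finitely many
    pointwise estimates bound the operator norm. Dividing [e] by the successor of [p + q] also
    covers dimension zero. *)
Lemma linear_family_uniform {T : Type} {p q m} (F : set_system T)
    (L : T -> {linear ('rV[R]_p * 'rV[R]_q)%type -> 'rV[R]_m})
    (L0 : {linear ('rV[R]_p * 'rV[R]_q)%type -> 'rV[R]_m}) : Filter F ->
  (forall v e, 0 < e -> \forall x \near F, `|L x v - L0 v| <= e) ->
  forall e : R, 0 < e -> \forall x \near F, forall v, `|L x v - L0 v| <= e * `|v|.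
Proof.
move=> FF LL e e0.
set N : R := (p + q).+1%:R; have N0 : 0 < N by rewrite ltr0n.
have near1 v : \forall x \near F, `|L x v - L0 v| <= e / N.
  by apply: LL; rewrite divr_gt0.
have near_l : \forall x \near F, forall j : 'I_p,
    `|L x (delta_mx 0 j, 0) - L0 (delta_mx 0 j, 0)| <= e / N.
  by apply: filter_forall => j; exact: near1.
have near_r : \forall x \near F, forall j : 'I_q,
    `|L x (0, delta_mx 0 j) - L0 (0, delta_mx 0 j)| <= e / N.
  by apply: filter_forall => j; exact: near1.
near=> x => -[u w].
have lx : forall j : 'I_p,
    `|L x (delta_mx 0 j, 0) - L0 (delta_mx 0 j, 0)| <= e / N by near: x.
have rx : forall j : 'I_q,
    `|L x (0, delta_mx 0 j) - L0 (0, delta_mx 0 j)| <= e / N by near: x.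
rewrite !linear_pair_sum opprD addrACA -!sumrB.
have nu : `|u| <= `|(u, w)| by rewrite [leRHS]/Num.Def.normr/= le_max lexx.
have nw : `|w| <= `|(u, w)| by rewrite [leRHS]/Num.Def.normr/= le_max lexx orbT.
set n := `|(u, w)| in nu nw *.
have bnd k (c : 'I_k -> R) (d : 'I_k -> 'rV[R]_m) :
    (forall j, `|c j| <= n) -> (forall j, `|d j| <= e / N) ->
    `|\sum_j c j *: d j| <= k%:R * (e / N * n).
  move=> cn de; rewrite (le_trans (ler_norm_sum _ _ _))//.
  rewrite mulr_natl -[k in leRHS]card_ord -sumr_const ler_sum// => j _.
  by rewrite normrZ mulrC ler_pM.
have -> : e * n = N * (e / N * n) by field; rewrite gt_eqF.
apply: le_trans (ler_normD _ _) _.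
apply: (@le_trans _ _ (p%:R * (e / N * n) + q%:R * (e / N * n))).
  apply: lerD.
  - under eq_bigr do rewrite -scalerBr.
    by apply: bnd => // j; rewrite (le_trans _ nu)// mx_entry_norm.
  - under eq_bigr do rewrite -scalerBr.
    by apply: bnd => // j; rewrite (le_trans _ nw)// mx_entry_norm.
rewrite -mulrDl -natrD ler_wpM2r ?ler_nat//.
by rewrite mulr_ge0 ?divr_ge0 ?(ltW e0) ?(ltW N0) ?(le_trans (normr_ge0 _) nu).
Unshelve. all: by end_near. Qed.

Lemma C1_diff_pointwise {V W : normedModType R} (f : V -> W) z v (e : R) :
  (\forall x \near z, continuously_differentiable f x) -> 0 < e ->
  \forall x \near z, `|'d f x v - 'd f z v| <= e.
Proof.
move=> fC1 e0; have [dfz Dfz] := nbhs_singleton fC1.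
have /cvgrPdist_le/(_ _ e0) H := Dfz v.
apply: filterS2 H fC1 => x + [dfx _].
by rewrite (deriveE v dfx) (deriveE v dfz) distrC.
Qed.

Lemma C1_diff_uniform {p q m} (f : 'rV[R]_p * 'rV[R]_q -> 'rV[R]_m) z :
  (\forall x \near z, continuously_differentiable f x) ->
  forall e : R, 0 < e ->
    \forall x \near z, forall v, `|'d f x v - 'd f z v| <= e * `|v|.
Proof.
move=> fC1.
have H v e : 0 < e -> \forall x \near z, `|'d f x v - 'd f z v| <= e.
  exact: C1_diff_pointwise.
exact: (@linear_family_uniform _ p q m (nbhs z) (fun x => 'd f x) ('d f z) _ H).
Qed.

End calculus_lemmas.

(** * The implicit function theorem *)

Section implicit_functions.
Context {R : realType}.

(** Strict differentiability at [(x0, y0)]: both points of the increment may move, which is what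
    turns the Newton step into a contraction. [J] and [K] act on row vectors from the right, and
    [Num.max] is the norm of the product space. *)
Definition strictly_differentiable_pair {p q m}
    (f : 'rV[R]_p -> 'rV[R]_q -> 'rV[R]_m) x0 y0
    (J : 'M[R]_(p, m)) (K : 'M[R]_(q, m)) : Prop :=
  forall e : R, 0 < e -> exists2 r : R, 0 < r & forall x x' y y',
    ball x0 r x -> ball x0 r x' -> ball y0 r y -> ball y0 r y' ->
    `|f x y - f x' y' - ((x - x') *m J + (y - y') *m K)| <=
      e * Num.max `|x - x'| `|y - y'|.

Lemma diff_partial1 {V V' W : normedModType R} (f : V * V' -> W) x y :
  differentiable f (x, y) -> differentiable (fun x' => f (x', y)) x /\
  forall u, 'd (fun x' => f (x', y)) x u = 'd f (x, y) (u, 0).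
Proof.
move=> df.
have dp : is_diff x (fun x' : V => (x', y)) (fun u => (u, 0 : V')).
  exact: is_diff_eq.
have [dpx dpE] := dp.
have dpx' : differentiable f ((fun x' : V => (x', y)) x) by [].
split; first exact: (differentiable_comp dpx dpx').
by move=> u; rewrite (diff_comp dpx dpx')/= dpE.
Qed.

Lemma diff_partial2 {V V' W : normedModType R} (f : V * V' -> W) x y :
  differentiable f (x, y) -> differentiable (fun y' => f (x, y')) y /\
  forall u, 'd (fun y' => f (x, y')) y u = 'd f (x, y) (0, u).
Proof.
move=> df.
have dp : is_diff y (fun y' : V' => (x, y')) (fun u => (0 : V, u)).
  exact: is_diff_eq.
have [dpx dpE] := dp.
have dpx' : differentiable f ((fun y' : V' => (x, y')) y) by [].
split; first exact: (differentiable_comp dpx dpx').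
by move=> u; rewrite (diff_comp dpx dpx')/= dpE.
Qed.

Lemma C1_strictly_differentiable_pair {p q m}
    (f : 'rV[R]_p -> 'rV[R]_q -> 'rV[R]_m) x0 y0 :
  (\forall z \near (x0, y0), continuously_differentiable
     (fun z : 'rV[R]_p * 'rV[R]_q => f z.1 z.2) z) ->
  strictly_differentiable_pair f x0 y0
    (jacobian (f ^~ y0) x0) (jacobian (f x0) y0).
Proof.
move=> fC1 e e0; pose F (z : 'rV[R]_p * 'rV[R]_q) := f z.1 z.2.
have dF : \forall z \near (x0, y0), differentiable F z.
  by apply: filterS fC1 => z [].
have dF0 : differentiable F (x0, y0) by exact: nbhs_singleton dF.
have [r r0 Fr] := strict_diff dF (C1_diff_uniform fC1) e0.
exists r => // x x' y y' xr x'r yr y'r.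
have := Fr (x', y') (x, y) (conj x'r y'r) (conj xr yr).
have -> : (x, y) - (x', y') = (x - x', y - y') by [].
have -> : (x - x', y - y') = (x - x', 0) + (0, y - y').
  by congr pair; rewrite ?addr0 ?add0r.
rewrite linearD -(diff_partial1 dF0).2 -(diff_partial2 dF0).2.
by rewrite /jacobian !mul_rV_lin1 -[_ + (0, _)]/(_, _) addr0 add0r.
Qed.

Section implicit_function.
Context {p q : nat} {f : 'rV[R]_p -> 'rV[R]_q -> 'rV[R]_p}
  {x0 : 'rV[R]_p} {y0 : 'rV[R]_q} {J : 'M[R]_p} {K : 'M[R]_(q, p)}.
Hypotheses (f_strict : strictly_differentiable_pair f x0 y0 J K)
  (Junit : J \in unitmx) (f0 : f x0 y0 = 0).

(** This is the Newton step with the derivative frozen at [(x0, y0)]. In the difference of two steps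
    the linear parts cancel, and the error of strict differentiability times [invmx J] remains; the
    tolerance [(2 * C)^-1] against the bound [C] on [invmx J] gives the factor one half, for all [y]
    near [y0] at once. *)
Lemma implicit_newton_contracts : exists C r : R, [/\ 0 < C, 0 < r,
    forall v : 'rV_p, `|v *m invmx J| <= C * `|v|
  & forall x x' y, ball x0 r x -> ball x0 r x' -> ball y0 r y ->
    `|(x - f x y *m invmx J) - (x' - f x' y *m invmx J)| <= 2^-1 * `|x - x'| ].
Proof.
have [C C0 JC] := row_mulmx_bound (invmx J).
have [|r r0 fr] := f_strict (e := (2 * C)^-1); first by rewrite invr_gt0 mulr_gt0.
exists C, r; split=> // x x' y xr x'r yr.
have := fr _ _ _ _ xr x'r yr yr.
rewrite subrr mul0mx addr0 normr0 max_l// => H.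
have -> : x - f x y *m invmx J - (x' - f x' y *m invmx J) =
    - ((f x y - f x' y - (x - x') *m J) *m invmx J).
  rewrite !mulmxBl !mulmxK// !opprB.
  by rewrite [_ - x' in LHS]addrC addrACA [- _ + _ in LHS]addrC.
rewrite normrN (le_trans (JC _))//.
apply: le_trans (_ : C * ((2 * C)^-1 * `|x - x'|) <= _).
  by rewrite ler_wpM2l// ltW.
by rewrite invfM mulrA mulrCA mulfV ?mulr1// gt_eqF.
Qed.

(** Zeros are fixed points of the Newton step, and a contraction has at most one. *)
Lemma implicit_unique : exists2 r : R, 0 < r & forall x x' y,
  ball x0 r x -> ball x0 r x' -> ball y0 r y ->
  f x y = 0 -> f x' y = 0 -> x = x'.
Proof.
have [C [r [C0 r0 _ fr]]] := implicit_newton_contracts.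
exists r => // x x' y xr x'r yr fx fx'.
have := fr _ _ _ xr x'r yr; rewrite fx fx' mul0mx !subr0.
apply: contraPP => /eqP; rewrite -subr_eq0 -normr_gt0; lra.
Qed.

(** Banach's theorem on the closed ball of radius [s] around [x0]. The Newton step stays in this
    ball because it moves the centre by at most [s / 2] and the contraction contributes at most
    another [s / 2]. *)
Lemma implicit_solution (r : R) : 0 < r ->
  \forall y \near y0, exists2 x, `|x - x0| < r & f x y = 0.
Proof.
move=> r0; have [C [r1 [C0 r1_gt0 JC fr]]] := implicit_newton_contracts.
have [|r2 r2_gt0 fr2] := f_strict (e := 1); first exact: ltr01.
have [CK CK0 KC] := row_mulmx_bound K.
(* Halving places the closed ball of radius [s] inside the open balls of radii [r] and [r1]. *)
pose s : R := Num.min r r1 / 2.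
have s0 : 0 < s by rewrite divr_gt0// lt_min r0.
have sr : s < r.
  by rewrite /s ltr_pdivrMr// mulr_natr mulr2n; case: (ltP r r1) => ?; lra.
have sr1 : s < r1.
  by rewrite /s ltr_pdivrMr// mulr_natr mulr2n; case: (ltP r r1) => ?; lra.
(* Strict differentiability with tolerance 1 gives [|f x0 y| <= (1 + CK) * |y - y0|]; this [t] makes
   [C * (1 + CK) * t] equal to [s / 2]. *)
pose t := s / (2 * C * (1 + CK)).
have t0 : 0 < t by rewrite divr_gt0// !mulr_gt0// addr_gt0.
near=> y.
pose psi x := x - f x y *m invmx J.
have yr1 : ball y0 r1 y by near: y; exact: nbhsx_ballx.
have yr2 : ball y0 r2 y by near: y; exact: nbhsx_ballx.
have ysmall : `|y - y0| < t.
  by rewrite distrC; near: y; exact: cvgr_dist_lt.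
have fx0y : C * `|f x0 y| <= s / 2.
  have := fr2 x0 x0 y y0 (ballxx _ r2_gt0) (ballxx _ r2_gt0) yr2 (ballxx _ r2_gt0).
  rewrite f0 subr0 subrr mul0mx add0r normr0 max_r// mul1r => H.
  have fb : `|f x0 y| <= (1 + CK) * `|y - y0|.
    rewrite -(subrK ((y - y0) *m K) (f x0 y)) (le_trans (ler_normD _ _))//.
    by rewrite mulrDl mul1r lerD.
  apply: (@le_trans _ _ (C * ((1 + CK) * t))).
    rewrite ler_wpM2l ?(ltW C0)//; apply: (le_trans fb).
    by rewrite ler_wpM2l ?(ltW ysmall)// ltW// addr_gt0.
  rewrite le_eqVlt; apply/orP; left; apply/eqP; rewrite /t; field.
  by rewrite !gt_eqF// addr_gt0.
pose U := closed_ball x0 s.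
have UE x : U x <-> `|x0 - x| <= s by rewrite /U closed_ballE.
have Ur1 x : U x -> ball x0 r1 x.
  by rewrite UE -ball_normE /ball_ /= => /le_lt_trans; apply.
have psiU : set_fun U U psi.
  move=> x Ux; rewrite UE.
  have := fr _ _ _ (Ur1 _ Ux) (ballxx x0 r1_gt0) yr1; rewrite -!/(psi _) => H.
  have -> : x0 - psi x = - ((psi x - psi x0) - f x0 y *m invmx J).
    have E : psi x0 + f x0 y *m invmx J = x0 by rewrite /psi subrK.
    move: (psi x) (psi x0) (f x0 y *m invmx J) E => u v a E.
    by rewrite -[X in X - u]E !opprB addrA [a + v]addrC.
  rewrite normrN (le_trans (ler_normB _ _))//.
  have := le_trans (JC _) fx0y; move: Ux; rewrite UE distrC; lra.
have [|||x Ux] := @banach_fixed_point R 'rV[R]_p U (mkfun psiU).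
- exists (2^-1)%:nng; split=> /=; first by rewrite invf_lt1// ltr1n.
  by move=> [a b] [/= Ua Ub]; apply: fr => //; exact: Ur1.
- exact: closed_ball_closed.
- by exists x0; rewrite UE subrr normr0 ltW.
move=> /= xE; exists x.
  by move: Ux; rewrite UE distrC => /le_lt_trans; apply.
have : f x y *m invmx J = 0.
  by move/eqP: xE; rewrite /psi -subr_eq0 opprB addrC subrK => /eqP.
by move/(congr1 (mulmx^~ J)); rewrite mulmxKV// mul0mx.
Unshelve. all: by end_near. Qed.

(** Within the radius of uniqueness the choice made by [xget] is forced, and [implicit_solution] for
    that same radius shows that there is something to choose for every [y] near [y0]. *)
Lemma implicit_exists : exists g, defined_implicitly f x0 y0 g.
Proof.
have [r r0 uniq_r] := implicit_unique.
pose g y := xget x0 [set x | `|x - x0| < r /\ f x y = 0].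
exists g; split.
  rewrite /g; case: xgetP => // x _ [xr fx].
  apply: (uniq_r _ _ y0) => //; try exact: ballxx.
  by rewrite -ball_normE /ball_ /= distrC.
exists (ball y0 r `&` [set y | exists2 x, `|x - x0| < r & f x y = 0], ball x0 r).
  split; last exact: nbhsx_ballx.
  by apply: filterI; [exact: nbhsx_ballx|exact: implicit_solution].
move=> [y x] [/= [yr [x1 x1r fx1]] xr].
have [gr fg] : `|g y - x0| < r /\ f (g y) y = 0.
  by rewrite /g; case: xgetP => [z _ //|/(_ x1)]; case.
split => [fx|->//].
by apply: (uniq_r _ _ y) => //; rewrite -ball_normE /ball_ /= distrC.
Qed.

Lemma implicit_diff g : defined_implicitly f x0 y0 g ->
  differentiable g y0 /\ jacobian g y0 = - (K *m invmx J).
Proof.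
move=> [g0 [[U V] /= [y0U x0V] gUV]].
have [C C0 JC] := row_mulmx_bound (invmx J).
have [C' C'0 KJC] := row_mulmx_bound (K *m invmx J).
(* Continuity of [g] at [y0] is not part of [defined_implicitly]. It follows because
   [implicit_solution] supplies a zero as close to [x0] as desired, and inside [V] such a zero must
   be [g y]. *)
have g_cvg (r : R) : 0 < r ->
    \forall y \near y0, `|g y - x0| < r /\ f (g y) y = 0.
  move=> r0; have /nbhs_ballP[s /= s0 sV] := x0V.
  have m0 : 0 < Num.min r s by rewrite lt_min r0.
  apply: filterS2 y0U (implicit_solution m0) => y Uy [x xm fx].
  have /andP[xr xs] : (`|x - x0| < r) && (`|x - x0| < s) by rewrite -lt_min.
  have Vx : V x by apply: sV; rewrite -ball_normE /ball_ /= distrC.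
  have xg : x = g y by apply/(gUV (y, x)).
  by rewrite -xg.
have est (e : R) : 0 < e -> \forall y \near y0,
    `|g y - g y0 - mulmxr (- (K *m invmx J)) (y - y0)| <= e * `|y - y0|.
  (* The first bound lets half of [m] be absorbed, whence [a <= (1 + 2 * C') * b] and
     [m <= (2 + 2 * C') * b]; the second then turns the error [C * e1 * m] into [e * b]. *)
  move=> e0; pose e1 := Num.min (2 * C)^-1 (e / (C * (2 + 2 * C'))).
  have e1_gt0 : 0 < e1.
    by rewrite lt_min invr_gt0 divr_gt0 ?mulr_gt0 ?addr_gt0 ?mulr_gt0.
  have [r r0 fr] := f_strict e1_gt0.
  have yr : \forall y \near y0, ball y0 r y by exact: nbhsx_ballx.
  apply: filterS2 yr (g_cvg _ r0) => y yr [gyr fgy].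
  have := fr (g y) x0 y y0 _ (ballxx _ r0) yr (ballxx _ r0).
  rewrite fgy f0 subrr sub0r normrN g0 /=.
  rewrite -ball_normE /ball_ /= distrC => /(_ gyr).
  set a := `|g y - x0|; set b := `|y - y0|; set m := Num.max a b => H.
  have -> : g y - x0 - (y - y0) *m - (K *m invmx J) =
      ((g y - x0) *m J + (y - y0) *m K) *m invmx J.
    by rewrite mulmxDl mulmxK// mulmxN opprK mulmxA.
  have H2 : `|((g y - x0) *m J + (y - y0) *m K) *m invmx J| <= C * (e1 * m).
    by rewrite (le_trans (JC _))// ler_wpM2l// ltW.
  apply: (le_trans H2).
  have b0 : 0 <= b by exact: normr_ge0.
  have a0 : 0 <= a by exact: normr_ge0.
  have m0 : 0 <= m by rewrite le_max a0.
  have Ce1 : C * (e1 * m) <= 2^-1 * m.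
    rewrite mulrA ler_wpM2r// mulrC -ler_pdivlMr// -invfM.
    by rewrite ge_min lexx.
  have Ce1' : C * e1 <= e / (2 + 2 * C').
    rewrite mulrC -ler_pdivlMr// -mulrA -invfM [_ * C]mulrC.
    by rewrite ge_min lexx orbT.
  have ab : a <= (1 + 2 * C') * b.
    have : a <= C * (e1 * m) + C' * b.
      rewrite /a; have -> : g y - x0 =
        ((g y - x0) *m J + (y - y0) *m K) *m invmx J - (y - y0) *m (K *m invmx J).
        by rewrite mulmxDl mulmxK// mulmxA addrK.
      by rewrite (le_trans (ler_normB _ _))// lerD.
    have : m <= a + b by rewrite ge_max lerDl lerDr b0.
    lra.
  have mb : m <= (2 + 2 * C') * b.
    have : 0 <= C' * b by rewrite mulr_ge0// ltW.
    rewrite /m ge_max => ?; apply/andP; split; lra.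
  apply: (@le_trans _ _ (C * e1 * ((2 + 2 * C') * b))).
    by rewrite mulrA ler_wpM2l// mulr_ge0// ltW.
  apply: (@le_trans _ _ (e / (2 + 2 * C') * ((2 + 2 * C') * b))).
    by rewrite ler_wpM2r// mulr_ge0// addr_ge0// mulr_ge0// ltW.
  rewrite mulrA divfK// gt_eqF// addr_gt0// mulr_gt0//.
have [dg dgE] :=
  estimate_diff (df := mulmxr (- (K *m invmx J))) (mulmxr_continuous (B := _)) est.
split=> //; apply/row_matrixP => i.
by rewrite !rowE /jacobian mul_rV_lin1 dgE.
Qed.

End implicit_function.

End implicit_functions.

(** * Mixtures and convergence in total variation *)

(** [pushforward] is a measure only by virtue of the measurability of [f]; with that proof as an
    argument the image is a term of the type of measures, on which [tv_cvg] is defined. *)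
Definition image_measure {R : realType} {d d'} {X : measurableType d}
    {Y : measurableType d'} (mu : {measure set X -> \bar R}) (f : X -> Y)
    (mf : measurable_fun setT f) : {measure set Y -> \bar R}.
Proof. by refine (pushforward mu f : {measure set Y -> \bar R}); exact: mf. Defined.

Section mixture.
Context {R : realType} {d d'} {X : measurableType d} {Z : measurableType d'}.
Variables (mu : {measure set X -> \bar R}) (kap : X -> {measure set Z -> \bar R})
  (nu : {measure set Z -> \bar R}).
Hypotheses
  (mkap : forall B, measurable B -> measurable_fun setT (fun x => kap x B))
  (nuE : forall B, measurable B -> nu B = (\int[mu]_x kap x B)%E).

Import HBNNSimple.

Let integral_mixture_nnsfun (h : {nnsfun Z >-> R}) :
  (\int[nu]_z (h z)%:E = \int[mu]_x \int[kap x]_z (h z)%:E)%E.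
Proof.
have mh r : measurable (h @^-1` [set r]) by exact: measurable_funPTI.
under [RHS]eq_integral do rewrite integralT_nnsfun sintegralE.
rewrite ge0_integral_fsum//; last 2 first.
- by move=> r; apply: measurable_funeM; exact: mkap.
- by move=> r x _; exact: nnsfun_mulemu_ge0.
rewrite integralT_nnsfun sintegralE; apply: eq_fsbigr => // r _.
have [r0|r0] := leP 0 r.
  by rewrite ge0_integralZl// ?lee_fin// ?nuE//; exact: mkap.
rewrite preimage_nnfun0// measure0 mule0 integral0_eq// => x _.
by rewrite measure0 mule0.
Qed.

(** The identity passes from sets to simple functions by linearity and to nonnegative functions by
    monotone convergence. [kap] is a plain family of measures, so that image laws, scaled Dirac
    masses and weighted sequences of laws all qualify. *)
Lemma ge0_integral_mixture (f : Z -> \bar R) : (forall z, 0 <= f z)%E ->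
  measurable_fun setT f ->
  (\int[nu]_z f z = \int[mu]_x \int[kap x]_z f z)%E.
Proof.
move=> f0 mf; pose g := nnsfun_approx measurableT mf.
have mg n : measurable_fun setT (EFin \o g n) by exact/measurable_EFinP.
have g0 n x : (0 <= (g n x)%:E)%E by rewrite lee_fin.
have ndg z : {homo (fun n => (g n z)%:E) : n m / (n <= m)%N >-> (n <= m)%E}.
  by move=> m n mn; rewrite lee_fin; exact/lefP/nd_nnsfun_approx.
have gf z : (g n z)%:E @[n --> \oo] --> f z by exact: cvg_nnsfun_approx.
have fE (m : {measure set Z -> \bar R}) :
    (\int[m]_z f z = limn (fun n => \int[m]_z (g n z)%:E))%E.
  rewrite -monotone_convergence//; apply: eq_integral => z _.
  by apply/esym/cvg_lim => //; exact: gf.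
rewrite fE; under eq_fun do rewrite integral_mixture_nnsfun.
rewrite -monotone_convergence//.
- by apply: eq_integral => x _; rewrite fE.
- move=> n; apply: (measurable_fun_integral_kernel mkap) => //; exact: mg.
- by move=> n x _; apply: integral_ge0.
- by move=> x _ m n mn; apply: ge0_le_integral => // *; first [exact: mg|exact: ndg].
Qed.

End mixture.

(** * Integrals of bounded and of dominated functions *)

Section bounded_integral.
Context {R : realType} {d} {T : measurableType d}.
Implicit Types (mu : {measure set T -> \bar R}) (h : T -> R).

Lemma integrable_le mu h w : mu.-integrable setT (EFin \o w) ->
  measurable_fun setT h -> (forall x, `|h x| <= w x) ->
  mu.-integrable setT (EFin \o h).
Proof.
move=> iw mh hw; apply: (le_integrable _ _ _ iw) => //.
  exact/measurable_EFinP.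
by move=> x _ /=; rewrite lee_fin (le_trans (hw x))// ler_norm.
Qed.

Lemma integrable_bounded mu h (C : R) : mu setT = 1%E ->
  measurable_fun setT h -> (forall x, `|h x| <= C) ->
  mu.-integrable setT (EFin \o h).
Proof.
move=> mu1 mh hC; apply: (@integrable_le _ _ (cst C)) => //.
apply: measurable_bounded_integrable => //; first by rewrite mu1 ltry.
exact: bounded_cst.
Qed.

Lemma integrable_addr mu f h : mu.-integrable setT (EFin \o f) ->
  mu.-integrable setT (EFin \o h) ->
  mu.-integrable setT (EFin \o (fun x => f x + h x)).
Proof. by move=> i1 i2; exact: (integrableD measurableT i1 i2). Qed.

Lemma integrable_subr mu f h : mu.-integrable setT (EFin \o f) ->
  mu.-integrable setT (EFin \o h) ->
  mu.-integrable setT (EFin \o (fun x => f x - h x)).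
Proof. by move=> i1 i2; exact: (integrableB measurableT i1 i2). Qed.

Lemma integrable_mulr mu h (r : R) : mu.-integrable setT (EFin \o h) ->
  mu.-integrable setT (EFin \o (fun x => r * h x)).
Proof. by move=> ih; exact: (integrableZl measurableT r ih). Qed.

Lemma unit_norm (a : R) : 0 <= a <= 1 -> `|a| <= 1.
Proof. by move=> /andP[a0 a1]; rewrite ger0_norm. Qed.

Lemma Rintegral_unit mu h : mu setT = 1%E -> measurable_fun setT h ->
  (forall x, 0 <= h x <= 1) -> 0 <= \int[mu]_x h x <= 1.
Proof.
move=> mu1 mh h01; rewrite Rintegral_ge0 => [|x _]; last by have /andP[] := h01 x.
have : \int[mu]_x h x <= \int[mu]_x (cst 1) x.
  apply: le_Rintegral => //.
  - by apply: (@integrable_bounded _ _ 1) => // x; exact: unit_norm.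
  - by apply: (@integrable_bounded _ _ 1) => // x; rewrite normr1.
  - by move=> x _; have /andP[] := h01 x.
by rewrite Rintegral_cst// mu1 mulr1.
Qed.

Lemma EFin_Rintegral mu h : mu.-integrable setT (EFin \o h) ->
  (\int[mu]_x h x)%:E = (\int[mu]_x (h x)%:E)%E.
Proof. by move=> ih; rewrite fineK//; exact: integrable_fin_num. Qed.

Lemma Rdominated_cvg0 mu (h : nat -> T -> R) w :
  mu.-integrable setT (EFin \o w) -> (forall k, measurable_fun setT (h k)) ->
  (forall k x, `|h k x| <= w x) ->
  (forall x, h k x @[k --> \oo] --> 0) ->
  \int[mu]_x h k x @[k --> \oo] --> 0.
Proof.
move=> iw mh hw h0.
have [] := @dominated_convergence _ T R mu setT measurableT
  (fun k => EFin \o h k) (cst 0%E) (EFin \o w) _ _ _ iw.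
- by move=> k; exact/measurable_EFinP.
- exact: measurable_cst.
- by apply: aeW => x _; apply: cvg_EFin; [exact: nearW|exact: h0].
- by apply: aeW => x k _ /=; rewrite lee_fin.
by rewrite integral0 => _ _ H; exact: fine_cvg H.
Qed.

End bounded_integral.

(** * Stability of convergence in total variation *)

Section total_variation.
Context {R : realType}.

(* mu_ k --> mu in total variation: integrals of [0, 1]-valued functions
   converge uniformly, expressed with a test function that depends on k. *)
Definition tv_cvg {d} {T : measurableType d}
    (mu_ : nat -> {measure set T -> \bar R})
    (mu : {measure set T -> \bar R}) : Prop :=
  forall h : nat -> T -> R, (forall k, measurable_fun setT (h k)) ->
    (forall k x, 0 <= h k x <= 1) ->
    \int[mu_ k]_x h k x - \int[mu]_x h k x @[k --> \oo] --> 0.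

(** Values in [0, 1] and total mass 1 keep the inner integrals finite, so [fine] loses nothing and
    the extended-real identity carries over. *)
Lemma Rintegral_mixture {d d'} {X : measurableType d} {Z : measurableType d'}
    (mu : {measure set X -> \bar R}) (kap : X -> {measure set Z -> \bar R})
    (nu : {measure set Z -> \bar R}) (h : Z -> R) :
  (forall B, measurable B -> measurable_fun setT (fun x => kap x B)) ->
  (forall B, measurable B -> nu B = (\int[mu]_x kap x B)%E) ->
  (forall x, kap x setT = 1%E) ->
  measurable_fun setT h -> (forall z, 0 <= h z <= 1) ->
  measurable_fun setT (fun x => \int[kap x]_z h z) /\
  \int[nu]_z h z = \int[mu]_x \int[kap x]_z h z.
Proof.
move=> mkap nuE kap1 mh h01.
have h0 z : (0 <= (h z)%:E)%E by rewrite lee_fin; have /andP[] := h01 z.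
have mEh : measurable_fun setT (EFin \o h) by exact/measurable_EFinP.
have hE x : (\int[kap x]_z h z)%:E = (\int[kap x]_z (h z)%:E)%E.
  apply: EFin_Rintegral; apply: (integrable_bounded (C := 1)) => // z.
  exact: unit_norm.
split.
  apply/measurable_EFinP; rewrite [X in measurable_fun _ X](_ : _ =
    (fun x => \int[kap x]_z (h z)%:E)%E); last by apply/funext => x /=; rewrite hE.
  exact: measurable_fun_integral_kernel.
rewrite /Rintegral (ge0_integral_mixture mkap nuE)//; congr fine.
by apply: eq_integral => x _; rewrite -hE.
Qed.

(** The difference splits into [H_ k] under [mu_ k] minus [H_ k] under [mu], plus [H_ k - H k] under
    [mu]. In the first part [H_ k] is again a [0, 1]-valued test function, but one that depends on
    [k]: this is why [tv_cvg] admits moving test functions. The second part is bounded by 1 and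
    tends to 0 pointwise, so the kernels need to converge only at each [x] separately. *)
Lemma tv_cvg_mixture {d d'} {X : measurableType d} {Z : measurableType d'}
    (mu_ : nat -> {measure set X -> \bar R}) (mu : {measure set X -> \bar R})
    (kap_ : nat -> X -> {measure set Z -> \bar R})
    (kap : X -> {measure set Z -> \bar R})
    (nu_ : nat -> {measure set Z -> \bar R}) (nu : {measure set Z -> \bar R}) :
  (forall k B, measurable B -> measurable_fun setT (fun x => kap_ k x B)) ->
  (forall B, measurable B -> measurable_fun setT (fun x => kap x B)) ->
  (forall k B, measurable B -> nu_ k B = (\int[mu_ k]_x kap_ k x B)%E) ->
  (forall B, measurable B -> nu B = (\int[mu]_x kap x B)%E) ->
  (forall k x, kap_ k x setT = 1%E) -> (forall x, kap x setT = 1%E) ->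
  (mu setT = 1)%E ->
  tv_cvg mu_ mu -> (forall x, tv_cvg (fun k => kap_ k x) (kap x)) ->
  tv_cvg nu_ nu.
Proof.
move=> mkap_ mkap nuE_ nuE kap1_ kap1 mu1 mu_mu kap_kap h mh h01.
pose H_ k x := \int[kap_ k x]_z h k z; pose H k x := \int[kap x]_z h k z.
have mH_ k : measurable_fun setT (H_ k) /\ \int[nu_ k]_z h k z = \int[mu_ k]_x H_ k x.
  exact: (Rintegral_mixture (mkap_ k) (nuE_ k) (kap1_ k) (mh k) (h01 k)).
have mH k : measurable_fun setT (H k) /\ \int[nu]_z h k z = \int[mu]_x H k x.
  exact: (Rintegral_mixture mkap nuE kap1 (mh k) (h01 k)).
have H_01 k x : 0 <= H_ k x <= 1 by exact: Rintegral_unit.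
have H01 k x : 0 <= H k x <= 1 by exact: Rintegral_unit.
have iH_ k : mu.-integrable setT (EFin \o H_ k).
  by apply: (integrable_bounded (C := 1)) => // [|x];
    [exact: (mH_ k).1|exact: unit_norm].
have iH k : mu.-integrable setT (EFin \o H k).
  by apply: (integrable_bounded (C := 1)) => // [|x];
    [exact: (mH k).1|exact: unit_norm].
have -> : (fun k => \int[nu_ k]_x h k x - \int[nu]_x h k x) =
    (fun k => (\int[mu_ k]_x H_ k x - \int[mu]_x H_ k x) +
              \int[mu]_x (H_ k x - H k x)).
  by apply/funext => k; rewrite (mH_ k).2 (mH k).2 RintegralB// addrA subrK.
rewrite -[0]addr0; apply: cvgD.
  by apply: mu_mu => // k; exact: (mH_ k).1.
apply: (@Rdominated_cvg0 _ _ _ _ _ (cst 1)).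
- by apply: (integrable_bounded (C := 1)) => // x; rewrite normr1.
- by move=> k; apply: measurable_funB; [exact: (mH_ k).1|exact: (mH k).1].
- move=> k x /=; rewrite ler_norml; move: (H_01 k x) (H01 k x).
  by move=> /andP[? ?] /andP[? ?]; apply/andP; split; lra.
- by move=> x; exact: kap_kap.
Qed.

Lemma tv_cvg_image {d d'} {X : measurableType d} {Z : measurableType d'}
    (mu_ : nat -> {measure set X -> \bar R}) (mu : {measure set X -> \bar R})
    (f : X -> Z) (mf : measurable_fun setT f) :
  tv_cvg mu_ mu ->
  tv_cvg (fun k => image_measure (mu_ k) mf) (image_measure mu mf).
Proof.
move=> mu_mu h mh h01.
have E k (m : {measure set X -> \bar R}) :
    \int[image_measure m mf]_x h k x = \int[m]_x h k (f x).
  rewrite /Rintegral ge0_integral_pushforward//; first exact/measurable_EFinP.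
  by move=> x _; rewrite lee_fin; have /andP[] := h01 k x.
under eq_fun do rewrite !E.
by apply: mu_mu => // k; exact: measurableT_comp.
Qed.

Lemma tv_cvg_ext {d} {T : measurableType d}
    (mu_ nu_ : nat -> {measure set T -> \bar R})
    (mu nu : {measure set T -> \bar R}) :
  (forall k B, measurable B -> mu_ k B = nu_ k B) ->
  (forall B, measurable B -> mu B = nu B) -> tv_cvg nu_ nu -> tv_cvg mu_ mu.
Proof.
move=> E_ E H h mh h01.
have -> : (fun k => \int[mu_ k]_x h k x - \int[mu]_x h k x) =
    (fun k => \int[nu_ k]_x h k x - \int[nu]_x h k x); last exact: H.
apply/funext => k; rewrite /Rintegral.
congr (fine _ - fine _).
  by apply: eq_measure_integral => B mB _; exact: E_.
by apply: eq_measure_integral => B mB _; exact: E.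
Qed.

Lemma tv_cvg_cst {d} {T : measurableType d}
    (mu : {measure set T -> \bar R}) : tv_cvg (fun=> mu) mu.
Proof.
by move=> h mh h01; under eq_fun do rewrite subrr; exact: cvg_cst.
Qed.

Lemma norm_squeeze_cvg0 {T : Type} (F : set_system T) {FF : Filter F}
    (a b : T -> R) : (forall k, `|a k| <= b k) ->
  b k @[k --> F] --> 0 -> a k @[k --> F] --> 0.
Proof.
move=> ab b0; apply/norm_cvg0P; apply: (@squeeze_cvgr _ _ _ _ (cst 0) b) => //.
  by apply: nearW => k /=; rewrite normr_ge0 ab.
exact: cvg_cst.
Qed.

(** A measure with density [p] is the mixture over [m] of the Dirac masses scaled by [p]. *)
Lemma Rintegral_density {d} {T : measurableType d}
    (m nu : {measure set T -> \bar R}) (p h : T -> R) :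
  measurable_fun setT p -> (forall x, 0 <= p x) ->
  (forall B, measurable B -> nu B = (\int[m]_(x in B) (p x)%:E)%E) ->
  measurable_fun setT h -> (forall x, 0 <= h x) ->
  \int[nu]_x h x = \int[m]_x (h x * p x).
Proof.
move=> mp p0 nuE mh h0.
pose kap x : {measure set T -> \bar R} := mscale (NngNum (p0 x)) (dirac x).
have kapE x B : kap x B = (p x * \1_B x)%:E by rewrite EFinM.
have mkap B : measurable B -> measurable_fun setT (fun x => kap x B).
  move=> mB; under eq_fun do rewrite kapE.
  by apply/measurable_EFinP; exact: measurable_funM.
have nu_kap B : measurable B -> nu B = (\int[m]_x kap x B)%E.
  move=> mB; rewrite nuE// integral_mkcond; apply: eq_integral => x _.
  rewrite kapE /patch indicE; case: ifPn => _; first by rewrite mulr1.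
  by rewrite mulr0.
have mEh : measurable_fun setT (EFin \o h) by exact/measurable_EFinP.
rewrite /Rintegral (ge0_integral_mixture mkap nu_kap)//; congr fine.
apply: eq_integral => x _; rewrite ge0_integral_mscale//.
  by rewrite integral_dirac//= diracT mul1e mulrC EFinM.
by move=> y _; rewrite lee_fin.
Qed.

(* Scheffe: since p_ k and p have the same total mass,
   `|p_ k - p| integrates to twice the positive part of p - p_ k, which p
   dominates. *)
Lemma tv_cvg_density {d} {T : measurableType d} (m : {measure set T -> \bar R})
    (p_ : nat -> T -> R) (p : T -> R)
    (nu_ : nat -> {measure set T -> \bar R}) (nu : {measure set T -> \bar R}) :
  (forall k, measurable_fun setT (p_ k)) -> measurable_fun setT p ->
  (forall k x, 0 <= p_ k x) -> (forall x, 0 <= p x) ->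
  (forall k B, measurable B -> nu_ k B = (\int[m]_(x in B) (p_ k x)%:E)%E) ->
  (forall B, measurable B -> nu B = (\int[m]_(x in B) (p x)%:E)%E) ->
  (forall k, nu_ k setT = 1%E) -> nu setT = 1%E ->
  (forall x, p_ k x @[k --> \oo] --> p x) -> tv_cvg nu_ nu.
Proof.
move=> mp_ mp p_0 p0 nuE_ nuE nu1_ nu1 pp h mh h01.
have integrable_dens (q : T -> R) : measurable_fun setT q -> (forall x, 0 <= q x) ->
    (\int[m]_x (q x)%:E = 1)%E -> m.-integrable setT (EFin \o q).
  move=> mq q0 q1; apply/integrableP; split; first exact/measurable_EFinP.
  under eq_integral do rewrite /= ger0_norm//.
  by rewrite q1 ltry.
have ip_ k : m.-integrable setT (EFin \o p_ k).
  by apply: integrable_dens => //; rewrite -nuE_.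
have ip : m.-integrable setT (EFin \o p) by apply: integrable_dens => //; rewrite -nuE.
pose b k := \int[m]_x Num.max (p x - p_ k x) 0.
have mb k : measurable_fun setT (fun x => Num.max (p x - p_ k x) 0).
  by apply: measurable_maxr => //; exact: measurable_funB.
have bp k x : `|Num.max (p x - p_ k x) 0| <= p x.
  rewrite ger0_norm; last by rewrite le_max lexx orbT.
  by rewrite ge_max p0 andbT lerBlDr lerDl.
have ib k : m.-integrable setT (EFin \o (fun x => Num.max (p x - p_ k x) 0)).
  exact: integrable_le (bp k).
have b0 : 2 * b k @[k --> \oo] --> 0.
  rewrite -[0](mulr0 2); apply: cvgMr.
  apply: (@Rdominated_cvg0 _ _ _ _ _ p) => // x.
  apply: (@norm_squeeze_cvg0 _ _ _ _ (fun k => `|p x - p_ k x|)) => [k|].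
    by case: (ltP (p x - p_ k x) 0) => _; rewrite ?normr0.
  apply/norm_cvg0P; rewrite -(subrr (p x)).
  by apply: cvgB => //; exact: cvg_cst.
apply: (norm_squeeze_cvg0 _ b0) => k.
have h_0 x : 0 <= h k x by have /andP[] := h01 k x.
have h_1 x : h k x <= 1 by have /andP[] := h01 k x.
rewrite (Rintegral_density (mp_ k) (p_0 k) (nuE_ k))//.
rewrite (Rintegral_density mp p0 nuE)//.
have ihp_ : m.-integrable setT (EFin \o (fun x => h k x * p_ k x)).
  apply: (integrable_le (ip_ k)); first exact: measurable_funM.
  by move=> x; rewrite ger0_norm ?mulr_ge0// ler_piMl.
have ihp : m.-integrable setT (EFin \o (fun x => h k x * p x)).
  apply: (integrable_le ip); first exact: measurable_funM.
  by move=> x; rewrite ger0_norm ?mulr_ge0// ler_piMl.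
have ipp : m.-integrable setT (EFin \o (fun x => p_ k x - p x)).
  exact: integrable_subr.
have pp0 : \int[m]_x (p_ k x - p x) = 0.
  by rewrite RintegralB// /Rintegral -nuE_// -nuE// nu1_ nu1 subrr.
rewrite -RintegralB// (le_trans (le_normr_Rintegral _ _))//.
  exact: integrable_subr.
have -> : 2 * b k = \int[m]_x ((p_ k x - p x) + 2 * Num.max (p x - p_ k x) 0).
  rewrite RintegralD// ?pp0 ?add0r ?RintegralZl//.
  exact: integrable_mulr.
apply: le_Rintegral => //.
- apply: (integrable_norm (f := fun x => h k x * p_ k x - h k x * p x)).
  exact: integrable_subr.
- by apply: integrable_addr => //; exact: integrable_mulr.
move=> x _; rewrite -mulrBr normrM ger0_norm//.
apply: (@le_trans _ _ `|p_ k x - p x|); first by rewrite ler_piMl.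
by case: (ltP (p x - p_ k x) 0) => ?; rewrite ler_norml; apply/andP; split; lra.
Qed.

(** The series is a mixture over the counting measure, and [c], which is summable, dominates the
    exchange of limit and sum. *)
Lemma tv_cvg_series {d} {T : measurableType d} (c : nat -> R)
    (sig_ : nat -> nat -> {measure set T -> \bar R})
    (sig : nat -> {measure set T -> \bar R})
    (nu_ : nat -> {measure set T -> \bar R}) (nu : {measure set T -> \bar R}) :
  (forall t, 0 <= c t) -> counting.-integrable setT (EFin \o c) ->
  (forall k B, measurable B ->
     nu_ k B = (\sum_(t <oo) (c t)%:E * sig_ k t B)%E) ->
  (forall B, measurable B -> nu B = (\sum_(t <oo) (c t)%:E * sig t B)%E) ->
  (forall k t, sig_ k t setT = 1%E) -> (forall t, sig t setT = 1%E) ->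
  (forall t, tv_cvg (fun k => sig_ k t) (sig t)) -> tv_cvg nu_ nu.
Proof.
move=> c0 ic nuE_ nuE sig1_ sig1 ss h mh h01.
have E (s : nat -> {measure set T -> \bar R}) (n : {measure set T -> \bar R})
    (f : T -> R) :
    (forall B, measurable B -> n B = (\sum_(t <oo) (c t)%:E * s t B)%E) ->
    (forall t, s t setT = 1%E) -> measurable_fun setT f ->
    (forall x, 0 <= f x <= 1) ->
    counting.-integrable setT (EFin \o (fun t => c t * \int[s t]_x f x)) /\
    \int[n]_x f x = \int[counting]_t (c t * \int[s t]_x f x).
  move=> nE s1 mf f01.
  have f0 x : (0 <= (f x)%:E)%E by rewrite lee_fin; have /andP[] := f01 x.
  have mEf : measurable_fun setT (EFin \o f) by exact/measurable_EFinP.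
  split.
    apply: (integrable_le ic) => // t.
    have /andP[r0 r1] := Rintegral_unit (s1 t) mf f01.
    by rewrite ger0_norm ?mulr_ge0// ler_piMr.
  pose kap t : {measure set T -> \bar R} := mscale (NngNum (c0 t)) (s t).
  have nkap B : measurable B -> n B = (\int[counting]_t kap t B)%E.
    by move=> mB; rewrite nE// ge0_integral_count// => t; exact: measure_ge0.
  rewrite /Rintegral (@ge0_integral_mixture _ _ _ _ _ counting kap n _ nkap)//.
  congr fine; apply: eq_integral => t _.
  rewrite ge0_integral_mscale//= EFinM; congr (_ * _)%E.
  rewrite fineK//; apply: integrable_fin_num => //.
  by apply: (integrable_bounded (C := 1)) => // x; exact: unit_norm.
have -> : (fun k => \int[nu_ k]_x h k x - \int[nu]_x h k x) = (fun k =>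
    \int[counting]_t (c t * \int[sig_ k t]_x h k x - c t * \int[sig t]_x h k x)).
  apply/funext => k.
  have [i1 ->] := E (sig_ k) (nu_ k) (h k) (nuE_ k) (sig1_ k) (mh k) (h01 k).
  have [i2 ->] := E sig nu (h k) nuE sig1 (mh k) (h01 k).
  by rewrite RintegralB.
apply: (Rdominated_cvg0 ic) => // [k t|t].
  have /andP[a0 a1] := Rintegral_unit (sig1_ k t) (mh k) (h01 k).
  have /andP[b0 b1] := Rintegral_unit (sig1 t) (mh k) (h01 k).
  rewrite -mulrBr normrM ger0_norm// ler_piMr// ler_norml.
  by apply/andP; split; lra.
under eq_fun do rewrite -mulrBr.
by rewrite -[0](mulr0 (c t)); apply: cvgMr; exact: ss.
Qed.

(** An affine change of variable carries [-N, N] to [0, 1]; its constant term has the same integral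
    under all the laws because they have mass 1. *)
Lemma tv_cvg_bounded {d} {T : measurableType d}
    (mu_ : nat -> {measure set T -> \bar R}) (mu : {measure set T -> \bar R})
    (h : nat -> T -> R) (N : R) :
  (forall k, mu_ k setT = 1%E) -> mu setT = 1%E -> tv_cvg mu_ mu -> 0 < N ->
  (forall k, measurable_fun setT (h k)) -> (forall k x, `|h k x| <= N) ->
  \int[mu_ k]_x h k x - \int[mu]_x h k x @[k --> \oo] --> 0.
Proof.
move=> mu1_ mu1 mumu N0 mh hN.
pose g k x := (h k x + N) / (2 * N).
have N20 : 0 < 2 * N by rewrite mulr_gt0.
have mg k : measurable_fun setT (g k).
  by apply: measurable_funM => //; exact: measurable_funD.
have g01 k x : 0 <= g k x <= 1.
  have := hN k x; rewrite ler_norml => /andP[? ?].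
  rewrite /g divr_ge0 ?(ltW N20)//=; last by lra.
  by rewrite ler_pdivrMr//; lra.
have E k (m : {measure set T -> \bar R}) : m setT = 1%E ->
    \int[m]_x h k x = 2 * N * \int[m]_x g k x - N.
  move=> m1.
  have ig : m.-integrable setT (EFin \o g k).
    by apply: (integrable_bounded (C := 1)) => // x; exact: unit_norm.
  have EN : \int[m]_x (cst N) x = N by rewrite Rintegral_cst// m1 mulr1.
  rewrite -[X in _ = _ - X]EN -RintegralZl// -RintegralB//.
  - by apply: eq_Rintegral => x _ /=; rewrite /g; field; rewrite gt_eqF.
  - exact: integrable_mulr.
  - by apply: (integrable_bounded (C := N)) => // x; rewrite ger0_norm// ltW.
under eq_fun do rewrite E// E// opprB addrA subrK -mulrBr.
by rewrite -[0](mulr0 (2 * N)); apply: cvgMr; exact: mumu.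
Qed.

End total_variation.

(** * Differentiation along moving measures *)

Section moving_measure.
Context {R : realType} {d} {T : measurableType d}.

(** If [w <= n] both sides vanish; otherwise the left side is the excess of [|h|] over [n], if
    any. *)
Lemma truncation_error (h w n : R) : 0 <= n -> `|h| <= w ->
  `|h - Num.max (- n) (Num.min h n)| <= w - Num.min w n.
Proof.
move=> n0; rewrite !ler_norml => /andP[? ?].
by case: (leP w n) => ?; case: (leP h n) => ?; case: (leP (- n) _) => ?;
  apply/andP; split; lra.
Qed.

(* Truncation at level N reduces to bounded test functions; the tails are
   controlled by the convergence of the integrals of w. *)
Lemma tv_cvg_dominated (mu_ : nat -> {measure set T -> \bar R})
    (mu : {measure set T -> \bar R}) (h : nat -> T -> R) (w : T -> R) :
  (forall k, mu_ k setT = 1%E) -> mu setT = 1%E -> tv_cvg mu_ mu ->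
  (forall k, (mu_ k).-integrable setT (EFin \o w)) ->
  mu.-integrable setT (EFin \o w) ->
  \int[mu_ k]_x w x @[k --> \oo] --> \int[mu]_x w x ->
  (forall k, measurable_fun setT (h k)) -> (forall k x, `|h k x| <= w x) ->
  \int[mu_ k]_x h k x - \int[mu]_x h k x @[k --> \oo] --> 0.
Proof.
move=> mu1_ mu1 mumu iw_ iw ww mh hw.
have mw : measurable_fun setT w by apply/measurable_EFinP; case/integrableP : iw.
have w0 x : 0 <= w x by rewrite (le_trans _ (hw 0%N x)).
pose wN (N : nat) x := Num.min (w x) N.+1%:R.
have mwN N : measurable_fun setT (wN N) by exact: measurable_minr.
have wN0 N x : 0 <= wN N x by rewrite le_min w0 ler0n.
have wNw N x : wN N x <= w x by rewrite ge_min lexx.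
have wNN N x : `|wN N x| <= N.+1%:R by rewrite ger0_norm// ge_min lexx orbT.
have iwN (m : {measure set T -> \bar R}) N : m.-integrable setT (EFin \o w) ->
    m.-integrable setT (EFin \o wN N).
  by move=> imw; apply: (integrable_le imw) => // x; rewrite ger0_norm.
have tail0 : \int[mu]_x (w x - wN N x) @[N --> \oo] --> 0.
  apply: (@Rdominated_cvg0 _ _ _ _ _ w) => //.
  - by move=> N; exact: measurable_funB.
  - by move=> N x; rewrite ger0_norm ?subr_ge0// gerBl.
  move=> x; apply/cvgrPdist_le => e e0; near=> N.
  have wN1 : w x <= N.+1%:R.
    apply: (@le_trans _ _ N%:R); last by rewrite ler_nat.
    by near: N; exact: nbhs_infty_ger.
  by rewrite sub0r normrN /wN min_l// subrr normr0 ltW.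
apply/cvgrPdist_lt => e e0.
have e4 : 0 < e / 4 by rewrite divr_gt0.
have [N tailN] : exists N, `|\int[mu]_x (w x - wN N x)| < e / 4.
  move/cvgrPdist_lt : tail0 => /(_ _ e4)[N _ /(_ N (leqnn N))] /=.
  by rewrite sub0r normrN => ?; exists N.
pose hN k x := Num.max (- N.+1%:R) (Num.min (h k x) N.+1%:R).
have mhN k : measurable_fun setT (hN k).
  by apply: measurable_maxr => //; exact: measurable_minr.
have hNN k x : `|hN k x| <= N.+1%:R.
  have N0 : 0 <= N.+1%:R :> R by exact: ler0n.
  rewrite ler_norml /hN le_max lexx /= ge_max ge_min lexx orbT andbT; lra.
have hhN k x : `|h k x - hN k x| <= w x - wN N x.
  exact: truncation_error.
have ih (m : {measure set T -> \bar R}) k : m.-integrable setT (EFin \o w) ->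
    m.-integrable setT (EFin \o h k) by move=> imw; exact: (integrable_le imw).
have ihN (m : {measure set T -> \bar R}) k : m setT = 1%E ->
    m.-integrable setT (EFin \o hN k).
  by move=> m1; exact: (integrable_bounded (C := N.+1%:R)).
have trunc (m : {measure set T -> \bar R}) k : m setT = 1%E ->
    m.-integrable setT (EFin \o w) ->
    `|\int[m]_x h k x - \int[m]_x hN k x| <= \int[m]_x w x - \int[m]_x wN N x.
  move=> m1 imw; rewrite -!RintegralB//; try by [exact: ih|exact: ihN|exact: iwN].
  rewrite (le_trans (le_normr_Rintegral _ _))//.
    by apply: integrable_subr; [exact: ih|exact: ihN].
  apply: le_Rintegral => //.
    apply: (integrable_norm (f := fun x => h k x - hN k x)).
    by apply: integrable_subr; [exact: ih|exact: ihN].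
  by apply: integrable_subr => //; exact: iwN.
have mid : \int[mu_ k]_x hN k x - \int[mu]_x hN k x @[k --> \oo] --> 0.
  by apply: (tv_cvg_bounded (N := N.+1%:R)).
have wNcvg : \int[mu_ k]_x wN N x - \int[mu]_x wN N x @[k --> \oo] --> 0.
  by apply: (tv_cvg_bounded (h := fun=> wN N) (N := N.+1%:R)).
rewrite RintegralB ?iwN// in tailN.
near=> k; rewrite sub0r normrN.
(* Truncation costs less than [e / 4] under [mu], hence less than [e / 4 + e / 8 + e / 8] under
   [mu_ k] by [K4] and [K5]; with [e / 8] from [K3] the total stays below [e]. *)
have K1 := trunc (mu_ k) k (mu1_ k) (iw_ k).
have K2 := trunc mu k mu1 iw.
have K3 : `|\int[mu_ k]_x hN k x - \int[mu]_x hN k x| < e / 8.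
  rewrite -normrN -[X in `|X|]add0r; near: k.
  by move/cvgrPdist_lt : mid; apply; rewrite divr_gt0.
have K4 : `|\int[mu_ k]_x wN N x - \int[mu]_x wN N x| < e / 8.
  rewrite -normrN -[X in `|X|]add0r; near: k.
  by move/cvgrPdist_lt : wNcvg; apply; rewrite divr_gt0.
have K5 : `|\int[mu]_x w x - \int[mu_ k]_x w x| < e / 8.
  by near: k; move/cvgrPdist_lt : ww; apply; rewrite divr_gt0.
move: tailN K1 K2 K3 K4 K5; rewrite !ler_norml !ltr_norml.
move=> /andP[? ?] /andP[? ?] /andP[? ?] /andP[? ?] /andP[? ?] /andP[? ?].
apply/andP; split; lra.
Unshelve. all: by end_near. Qed.

(** The derivative is the pointwise limit of difference quotients with steps [1 / (n + 1)]. Shifting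
    the index by [N] discards the early points [y n], which may lie outside the neighbourhood where
    [F] is measurable. *)
Lemma measurable_derive {V : normedModType R} (F : V -> T -> R) (x v : V) :
  (\forall y \near x, measurable_fun setT (F y)) ->
  (forall z, derivable (F ^~ z) x v) ->
  measurable_fun setT (fun z => 'D_v (F ^~ z) x).
Proof.
move=> mF dF.
pose y (n : nat) : V := n.+1%:R^-1 *: v + x.
have yx : y n @[n --> \oo] --> x.
  rewrite -[X in _ --> X]add0r -(scale0r v); apply: cvgD; last exact: cvg_cst.
  by apply: cvgZr_tmp; exact: cvg_harmonic.
have [N _ Ny] := yx _ mF.
have mFx : measurable_fun setT (F x) := nbhs_singleton mF.
pose q n z := n.+1%:R * (F (y n) z - F x z).
apply: (@measurable_fun_cvg _ _ _ _ (fun n => q (n + N)%N)).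
- move=> n; apply: measurable_funM => //; apply: measurable_funB => //.
  by apply: Ny; rewrite /= leq_addl.
move=> z _.
have : (fun h : R => h^-1 *: ((F ^~ z \o shift x) (h *: v) - F x z)) h
    @[h --> 0^'] --> 'D_v (F ^~ z) x by exact: dF.
have hn0 : (n + N).+1%:R^-1 @[n --> \oo] --> (0 : R).
  by rewrite (cvg_shiftn N (fun n => n.+1%:R^-1 : R)); exact: cvg_harmonic.
have hn : (n + N).+1%:R^-1 @[n --> \oo] --> (0 : R)^'.
  move=> A A0.
  have : \forall n \near \oo, (n + N).+1%:R^-1 != 0 :> R -> A (n + N).+1%:R^-1.
    exact: (hn0 _ A0).
  by apply: filterS => n; apply; rewrite invr_eq0 pnatr_eq0.
move=> Hd; have := cvg_comp _ _ hn Hd; apply: cvg_trans; apply: near_eq_cvg.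
by apply: nearW => n; rewrite /q /y /= invrK.
Qed.

(** If [P] failed arbitrarily close to [x0], choosing a failure in each ball of radius [1 / (k + 1)]
    would give a sequence that never meets [P]. [Q] confines the sequence to a good neighbourhood
    from its first term on. *)
Lemma near_of_seq {V : normedModType R} (x0 : V) (P Q : V -> Prop) :
  (\forall x \near x0, Q x) ->
  (forall u : nat -> V, (forall k, Q (u k)) -> u k @[k --> \oo] --> x0 ->
     exists k, P (u k)) ->
  \forall x \near x0, P x.
Proof.
move=> nQ seqP; apply/not_notP => nP.
have ex k : exists y, [/\ ball x0 k.+1%:R^-1 y, Q y & ~ P y].
  apply/not_existsP => H; apply: nP.
  have kb : \forall y \near x0, ball x0 (k.+1%:R^-1 : R) y.
    by apply: nbhsx_ballx; rewrite invr_gt0.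
  apply: filterS2 nQ kb => y Qy yk; apply/not_notP => nPy.
  by apply: (H y).
have [u uP] := choice ex.
have [k] : exists k, P (u k).
  apply: seqP => [k|]; first by have [] := uP k.
  apply/cvgrPdist_lt => e e0; near=> k.
  have [+ _ _] := uP k; rewrite -ball_normE /ball_ /= => /lt_trans; apply.
  by near: k; exact: near_infty_natSinv_lt (PosNum e0).
by have [] := uP k.
Unshelve. all: by end_near. Qed.

Lemma derive_sum {p} (f : 'rV[R]_p -> R) x v : differentiable f x ->
  'D_v f x = \sum_j v 0 j * 'D_(delta_mx 0 j) f x.
Proof.
move=> df; rewrite deriveE// [in LHS](row_sum_delta v) linear_sum.
by apply: eq_bigr => j _; rewrite linearZ deriveE.
Qed.

Lemma norm_row_sum {p} (v : 'rV[R]_p) (c : 'I_p -> R) (C : R) :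
  (forall j, `|c j| <= C) -> `|\sum_j v 0 j * c j| <= p%:R * C * `|v|.
Proof.
move=> cC; rewrite (le_trans (ler_norm_sum _ _ _))//.
rewrite -mulrA mulr_natl.
have -> : C * `|v| *+ p = \sum_(j < p) C * `|v| by rewrite sumr_const card_ord.
apply: ler_sum => j _.
by rewrite normrM mulrC ler_pM// mx_entry_norm.
Qed.

Lemma Rintegral_row_sum {p} (mu : {measure set T -> \bar R}) (v : 'rV[R]_p)
    (c : 'I_p -> T -> R) :
  (forall j, mu.-integrable setT (EFin \o c j)) ->
  mu.-integrable setT (EFin \o (fun z => \sum_j v 0 j * c j z)) /\
  \int[mu]_z (\sum_j v 0 j * c j z) = \sum_j v 0 j * \int[mu]_z c j z.
Proof.
move=> ic.
suff H (r : seq 'I_p) :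
    mu.-integrable setT (EFin \o (fun z => \sum_(j <- r) v 0 j * c j z)) /\
    \int[mu]_z (\sum_(j <- r) v 0 j * c j z) =
    \sum_(j <- r) v 0 j * \int[mu]_z c j z by exact: H.
elim: r => [|j r [IH1 IH2]].
  split; last first.
    under eq_Rintegral do rewrite big_nil.
    by rewrite big_nil Rintegral_cst// mul0r.
  by under eq_fun do rewrite big_nil; exact: integrable0.
have ij : mu.-integrable setT (EFin \o (fun z => v 0 j * c j z)).
  exact: integrable_mulr.
split.
  under [X in EFin \o X]eq_fun do rewrite big_cons.
  exact: integrable_addr.
under eq_Rintegral do rewrite big_cons.
by rewrite RintegralD// RintegralZl// IH2 big_cons.
Qed.

Lemma cvg_add0 (a b : nat -> R) : a k @[k --> \oo] --> 0 ->
  b k @[k --> \oo] --> 0 -> a k + b k @[k --> \oo] --> 0.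
Proof. by move=> a0 b0; rewrite -[0]addr0; exact: cvgD. Qed.

Lemma cvg_sum0 {p} (a : nat -> 'I_p -> R) :
  (forall j, a k j @[k --> \oo] --> 0) -> \sum_j a k j @[k --> \oo] --> 0.
Proof.
move=> a0; suff H (s : seq 'I_p) : \sum_(j <- s) a k j @[k --> \oo] --> 0.
  exact: H.
elim: s => [|j s IH].
  have -> : (fun k => \sum_(j <- [::]) a k j) = cst 0.
    by apply/funext => k; rewrite big_nil.
  exact: cvg_cst.
have -> : (fun k => \sum_(i <- j :: s) a k i) =
    (fun k => a k j + \sum_(i <- s) a k i).
  by apply/funext => k; rewrite big_cons.
exact: cvg_add0.
Qed.

(** The normalized remainder [rem k] is dominated by a multiple of [w], by the mean value bound, and
    tends to 0 pointwise, so its integral under the moving law tends to 0. Replacing the moving law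
    by [mu x0] in the linear part costs [|x - x0|] times another quantity that tends to 0. *)
Lemma moving_measure_derive {p} (mu : 'rV[R]_p -> {measure set T -> \bar R})
    (F : 'rV[R]_p -> T -> R) (x0 : 'rV[R]_p) (w : T -> R) :
  (forall x, mu x setT = 1%E) ->
  (forall u : nat -> 'rV[R]_p, u k @[k --> \oo] --> x0 ->
     tv_cvg (mu \o u) (mu x0)) ->
  (\forall x \near x0, (mu x).-integrable setT (EFin \o w)) ->
  \int[mu x]_z w z @[x --> x0] --> \int[mu x0]_z w z ->
  (\forall x \near x0, measurable_fun setT (F x)) ->
  (\forall x \near x0, forall z, differentiable (F ^~ z) x) ->
  (\forall x \near x0, forall z, `|F x z| <= w z) ->
  (\forall x \near x0, forall z j, `|'D_(delta_mx 0 j) (F ^~ z) x| <= w z) ->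
  forall e : R, 0 < e -> \forall x \near x0,
    `|\int[mu x]_z F x z - \int[mu x]_z F x0 z
      - \sum_j (x - x0) 0 j * \int[mu x0]_z 'D_(delta_mx 0 j) (F ^~ z) x0|
    <= e * `|x - x0|.
Proof.
move=> mu1 mu_cvg near_iw w_cvg near_mF near_dF near_Fw near_DFw e e0.
have iw0 := nbhs_singleton near_iw.
pose D j z := 'D_(delta_mx 0 j) (F ^~ z) x0.
have mD j : measurable_fun setT (D j).
  apply: measurable_derive => // z; apply: diff_derivable.
  exact: (nbhs_singleton near_dF).
have Dw j z : `|D j z| <= w z by exact: (nbhs_singleton near_DFw).
have w0 z : 0 <= w z by rewrite (le_trans _ (nbhs_singleton near_Fw z)).
have near_all : \forall x \near x0, [/\ (mu x).-integrable setT (EFin \o w),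
    measurable_fun setT (F x), forall z, differentiable (F ^~ z) x,
    forall z, `|F x z| <= w z & forall z j, `|'D_(delta_mx 0 j) (F ^~ z) x| <= w z].
  near=> x; split; near: x => //.
have /nbhs_ballP[r /= r0 allr] := near_all.
(* A ball is convex, so the whole segment from [x0] to [u k] stays where the partial derivatives are
   bounded by [w]; [Fdiff] relies on it. *)
apply: (near_of_seq (Q := ball x0 r)); first exact: nbhsx_ballx.
move=> u ur ux0.
have mF k : measurable_fun setT (F (u k)) by have [] := allr _ (ur k).
have mF0 : measurable_fun setT (F x0) := nbhs_singleton near_mF.
have iw k : (mu (u k)).-integrable setT (EFin \o w) by have [] := allr _ (ur k).
pose v k : 'rV[R]_p := u k - x0.
have v0 : `|v k| @[k --> \oo] --> 0.
  apply/norm_cvg0P; rewrite -(subrr x0); apply: cvgB => //; exact: cvg_cst.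
pose L k z := \sum_j v k 0 j * D j z.
have mL k : measurable_fun setT (L k).
  by apply: measurable_sum => j; exact: measurable_funM.
pose rem k z := `|v k|^-1 * (F (u k) z - F x0 z - L k z).
have mrem k : measurable_fun setT (rem k).
  apply: measurable_funM => //; apply: measurable_funB => //.
  exact: measurable_funB.
have Lw k z : `|L k z| <= p%:R * w z * `|v k| by exact: norm_row_sum.
have Fdiff k z : `|F (u k) z - F x0 z| <= p%:R * w z * `|v k|.
  have -> : u k = x0 + v k by rewrite /v addrC subrK.
  apply: (mean_value_bound (f := F ^~ z)) => t t01.
  have xr : ball x0 r (x0 + t *: v k).
    have := ur k; rewrite -ball_normE /ball_ /= distrC => ukr.
    rewrite opprD addrA subrr sub0r normrN normrZ (le_lt_trans _ ukr)//.
    by move: t01; rewrite in_itv /= => /andP[? ?]; rewrite ler_piMl// ger0_norm.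
  have [_ _ dFx _ DFx] := allr _ xr.
  split; first exact/diff_derivable/dFx.
  rewrite derive_sum; last exact: dFx.
  by apply: norm_row_sum => j; exact: DFx.
(* Since [0^-1 = 0], the bound also holds when [u k = x0], where [rem k] vanishes. *)
have vK k : `|v k|^-1 * (`|v k| * 1) <= 1 :> R.
  by rewrite mulr1; have [->|?] := eqVneq `|v k| 0; rewrite ?mulr0 ?mulVf.
have remw k z : `|rem k z| <= 2 * p%:R * w z.
  rewrite /rem normrM ger0_norm ?invr_ge0//.
  apply: (@le_trans _ _ (`|v k|^-1 * (2 * p%:R * w z * `|v k|))).
    rewrite ler_wpM2l ?invr_ge0// (le_trans (ler_normB _ _))//.
    have := Fdiff k z; have := Lw k z; lra.
  have c0 : 0 <= 2 * p%:R * w z by rewrite !mulr_ge0.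
  have := ler_wpM2l c0 (vK k); rewrite !mulr1 => H; apply: le_trans H.
  by rewrite mulrCA.
have rem0 z : rem k z @[k --> \oo] --> 0.
  apply/cvgrPdist_le => c c0.
  have dF0 : differentiable (F ^~ z) x0 by exact: (nbhs_singleton near_dF).
  have est : \forall k \near \oo, `|F (u k) z - F x0 z
      - 'd (F ^~ z) x0 (u k - x0)| <= c * `|u k - x0|.
    exact: (ux0 _ (diff_estimate dF0 c0)).
  apply: filterS est => k.
  have -> : 'd (F ^~ z) x0 (u k - x0) = L k z.
    by rewrite -deriveE// derive_sum.
  move=> H; rewrite sub0r normrN /rem normrM ger0_norm ?invr_ge0//.
  apply: (@le_trans _ _ (`|v k|^-1 * (c * `|v k|))).
    by rewrite ler_wpM2l ?invr_ge0.
  by have := ler_wpM2l (ltW c0) (vK k); rewrite !mulr1 mulrCA.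
pose I j := \int[mu x0]_z D j z.
have iw2 (m : {measure set T -> \bar R}) : m.-integrable setT (EFin \o w) ->
    m.-integrable setT (EFin \o (fun z => 2 * p%:R * w z)).
  by move=> imw; exact: integrable_mulr.
have tv : tv_cvg (mu \o u) (mu x0) by exact: mu_cvg.
have wu : \int[mu (u k)]_z w z @[k --> \oo] --> \int[mu x0]_z w z.
  exact: (cvg_comp _ _ ux0 w_cvg).
have int_rem0 : \int[mu (u k)]_z rem k z @[k --> \oo] --> 0.
  have H1 : \int[mu (u k)]_z rem k z - \int[mu x0]_z rem k z @[k --> \oo] --> 0.
    apply: (@tv_cvg_dominated (mu \o u) (mu x0) rem _ (fun k => mu1 (u k))
      (mu1 x0) tv (fun k => iw2 _ (iw k)) (iw2 _ iw0) _ mrem remw).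
    rewrite RintegralZl//.
    have -> : (fun k => \int[(mu \o u) k]_x (2 * p%:R * w x)) =
          (fun k => 2 * p%:R * \int[mu (u k)]_x w x).
      by apply/funext => k; apply: RintegralZl => //; exact: iw.
    exact: cvgMr.
  have H2 : \int[mu x0]_z rem k z @[k --> \oo] --> 0.
    exact: (Rdominated_cvg0 (iw2 _ iw0)).
  have -> : (fun k => \int[mu (u k)]_z rem k z) = (fun k =>
      (\int[mu (u k)]_z rem k z - \int[mu x0]_z rem k z)
      + \int[mu x0]_z rem k z) by apply/funext => k; rewrite subrK.
  by rewrite -[0]addr0; exact: cvgD.
have intD0 j : `|\int[mu (u k)]_z D j z - I j| @[k --> \oo] --> 0.
  apply/norm_cvg0P.
  exact: (@tv_cvg_dominated (mu \o u) (mu x0) (fun=> D j) w (fun k => mu1 (u k))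
    (mu1 x0) tv iw iw0 wu (fun=> mD j) (fun=> Dw j)).
have bracket : `|\int[mu (u k)]_z rem k z|
    + \sum_j `|\int[mu (u k)]_z D j z - I j| @[k --> \oo] --> 0.
  have H1 : `|\int[mu (u k)]_z rem k z| @[k --> \oo] --> 0 by exact/norm_cvg0P.
  exact: (cvg_add0 H1 (cvg_sum0 intD0)).
have [k kb] : exists k, `|\int[mu (u k)]_z rem k z|
    + \sum_j `|\int[mu (u k)]_z D j z - I j| <= e.
  move/cvgrPdist_le : bracket => /(_ _ e0)[k _ /(_ k (leqnn k))] /=.
  rewrite sub0r normrN ger0_norm ?addr_ge0 ?sumr_ge0// => ?; by exists k.
exists k.
have iD j : (mu (u k)).-integrable setT (EFin \o D j).
  exact: (integrable_le (iw k)).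
have irem : (mu (u k)).-integrable setT (EFin \o rem k).
  exact: (integrable_le (iw2 _ (iw k))).
have iF : (mu (u k)).-integrable setT (EFin \o F (u k)).
  by apply: (integrable_le (iw k)) => //; have [] := allr _ (ur k).
have iF0 : (mu (u k)).-integrable setT (EFin \o F x0).
  by apply: (integrable_le (iw k)) => //; exact: (nbhs_singleton near_Fw).
have [iL intL] := Rintegral_row_sum (v k) iD.
(* Integrating [L k] under the moving law produces the integrals of [D j] under [mu (u k)]; the last
   sum accounts for their distance to [I j]. *)
have -> : \int[mu (u k)]_z F (u k) z - \int[mu (u k)]_z F x0 z
      - \sum_j (u k - x0) 0 j * I j =
    `|v k| * \int[mu (u k)]_z rem k z
    + \sum_j v k 0 j * (\int[mu (u k)]_z D j z - I j).
  have -> : \sum_j v k 0 j * (\int[mu (u k)]_z D j z - I j) =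
      \int[mu (u k)]_z L k z - \sum_j v k 0 j * I j.
    by rewrite intL -sumrB; apply: eq_bigr => j _; rewrite mulrBr.
  rewrite addrA; congr (_ - _).
  rewrite -RintegralZl// -RintegralB// -RintegralD//.
    apply: eq_Rintegral => z _; rewrite /rem mulrA.
    have [vk0|vk0] := eqVneq (v k) 0; last first.
      by rewrite mulfV ?mul1r ?subrK// normr_eq0.
    have -> : u k = x0 by apply/eqP; rewrite -subr_eq0; apply/eqP.
    rewrite subrr vk0 normr0 mul0r mul0r add0r /L big1// => j _.
    by rewrite vk0 mxE mul0r.
  exact: integrable_mulr.
rewrite (le_trans (ler_normD _ _))//.
apply: (@le_trans _ _ ((`|\int[mu (u k)]_z rem k z|
    + \sum_j `|\int[mu (u k)]_z D j z - I j|) * `|v k|)); last first.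
  by rewrite ler_wpM2r.
rewrite mulrDl lerD//; first by rewrite normrM normr_id mulrC.
rewrite (le_trans (ler_norm_sum _ _ _))// mulr_suml ler_sum// => j _.
by rewrite normrM mulrC ler_wpM2l// mx_entry_norm.
Unshelve. all: by end_near. Qed.

End moving_measure.

(** * The laws of the simulated chain *)

Section semidirect_lemmas.
Context {R : realType} {d d'} {X : measurableType d} {Y : measurableType d'}.
Implicit Types (mu : {measure set X -> \bar R}) (k : R.-pker X ~> Y).

(** The law of (x, y) for a fixed [x], which exhibits [semidirect] as a mixture over [mu]. *)
Definition section_law k (x : X) : {measure set (X * Y) -> \bar R} :=
  image_measure (k x) (pair1_measurable x).

Lemma section_lawE k x B : section_law k x B = k x (xsection B x).
Proof.
rewrite /section_law /image_measure /= /pushforward; congr (k x _).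
by apply/seteqP; split => y /=; rewrite /xsection/= inE.
Qed.

Lemma measurable_section_law k B : measurable B ->
  measurable_fun setT (fun x => section_law k x B).
Proof.
move=> mB; under eq_fun do rewrite section_lawE.
by apply: measurable_fun_xsection_finite_kernel; rewrite inE.
Qed.

Lemma semidirect_mixture mu k B : measurable B ->
  semidirect mu k B = (\int[mu]_x section_law k x B)%E.
Proof. by move=> mB; apply: eq_integral => x _; rewrite section_lawE. Qed.

Lemma section_law_setT k x : section_law k x setT = 1%E.
Proof. exact: prob_kernel. Qed.

Lemma semidirect_setT mu k : mu setT = 1%E -> semidirect mu k setT = 1%E.
Proof.
move=> mu1; rewrite semidirect_mixture//.
under eq_integral do rewrite section_law_setT.
by rewrite integral_cst// mul1e.
Qed.

Lemma tv_cvg_semidirect (mu_ : nat -> {measure set X -> \bar R}) mu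
    (k_ : nat -> R.-pker X ~> Y) k : (mu setT = 1)%E -> tv_cvg mu_ mu ->
  (forall x, tv_cvg (fun n => k_ n x) (k x)) ->
  tv_cvg (fun n => semidirect (mu_ n) (k_ n)) (semidirect mu k).
Proof.
move=> mu1 mumu kk.
apply: (@tv_cvg_mixture _ _ _ _ _ mu_ mu (fun n => section_law (k_ n)) (section_law k)).
- by move=> n B mB; exact: measurable_section_law.
- by move=> B mB; exact: measurable_section_law.
- by move=> n B mB; exact: semidirect_mixture.
- by move=> B mB; exact: semidirect_mixture.
- by move=> n x; exact: section_law_setT.
- by move=> x; exact: section_law_setT.
- exact: mu1.
- exact: mumu.
- by move=> x; apply: tv_cvg_image; exact: kk.
Qed.

End semidirect_lemmas.

(** * Measurability of limits and of integrals against kernels *)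

Section limn_measurable.
Context {R : realType} {d} {T : measurableType d}.

Lemma limn_einf_esup_cvg (u : nat -> \bar R) : limn_einf u = limn_esup u ->
  u n @[n --> \oo] --> limn_esup u.
Proof.
move=> E; apply: (@squeeze_cvge _ _ _ _ (einfs u) _ (esups u)).
- apply: nearW => n; apply/andP; split.
    by apply: ereal_inf_lbound; exists n => /=.
  by apply: ereal_sup_ubound; exists n => /=.
- rewrite -E limn_einf_lim; exact: is_cvg_einfs.
- rewrite limn_esup_lim; exact: is_cvg_esups.
Qed.

(** The discounted reward series in the critic is signed and may diverge on some trajectories, where
    [limn] is the default [point]. Convergence is the equality of lower and upper limits, a
    measurable condition. *)
Lemma measurable_fun_limn (f : nat -> T -> \bar R) :
  (forall n, measurable_fun setT (f n)) ->
  measurable_fun setT (fun x => limn (f ^~ x)).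
Proof.
move=> mf.
have msup : measurable_fun setT (fun x => limn_esup (f ^~ x)).
  exact: measurable_fun_limn_esup.
have minf : measurable_fun setT (fun x => limn_einf (f ^~ x)).
  apply: measurableT_comp => //.
  by apply: measurable_fun_limn_esup => n; exact: measurableT_comp.
rewrite [X in measurable_fun _ X](_ : _ = (fun x =>
    if limn_einf (f ^~ x) == limn_esup (f ^~ x) then limn_esup (f ^~ x)
    else point)).
  by apply: measurable_fun_ifT => //; exact: measurable_fun_eqe.
apply/funext => x; case: eqP => [E|NE].
  by apply/cvg_lim => //; exact: limn_einf_esup_cvg.
apply: dvgP => cf; apply: NE.
by rewrite is_cvg_limn_einfE// is_cvg_limn_esupE.
Qed.

Lemma measurable_fun_integral_signed {d'} {Y : measurableType d'}
    (k : R.-pker T ~> Y) (f : Y -> \bar R) : measurable_fun setT f ->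
  measurable_fun setT (fun x => \int[k x]_y f y)%E.
Proof.
move=> mf; under eq_fun do rewrite integralE.
by apply: emeasurable_funB; apply: measurable_fun_integral_kernel => //;
  [exact: measurable_kernel|exact: measurable_funepos|exact: measurable_kernel
  |exact: measurable_funeneg].
Qed.

End limn_measurable.

(** * Marginal laws of the chain and their continuity in the parameters *)

Section simulation_laws.
Context {R : realType} {dS dA dW : measure_display} {S : measurableType dS}
  {A : measurableType dA} {W : measurableType dW} {m n : nat}.
Variable M : simulation R S A W m n.
Implicit Types (phi : 'rV[R]_m) (th : 'rV[R]_n).

Definition init_law phi : {measure set (S * A) -> \bar R} :=
  semidirect (init M) (policy M phi).

Lemma init_law_setT phi : init_law phi setT = 1%E.
Proof. by apply: semidirect_setT; exact: probability_setT. Qed.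

Lemma measurable_step_snd t :
  measurable_fun setT (fun zw : (S * A) * W => step M t zw.2).
Proof. exact: measurableT_comp. Qed.

(** The law of (s_t, a_t). The recursion runs on pairs because it is the pair that is Markov;
    [state_law] is the first marginal. *)
Definition step_law phi th t : {measure set (S * A) -> \bar R} :=
  image_measure (semidirect (init_law phi) (traj M phi th)) (measurable_step_snd t).

Definition move_law phi th (z : S * A) : {measure set (S * A) -> \bar R} :=
  semidirect (trans M th z) (policy M phi).

Lemma step_lawE phi th t B :
  step_law phi th t B =
  (\int[init_law phi]_z traj M phi th z (step M t @^-1` B))%E.
Proof.
apply: eq_integral => z _; congr (traj M phi th z _).
by apply/seteqP; split => w /=; rewrite /xsection/= inE.
Qed.

Lemma step_law_setT phi th t : step_law phi th t setT = 1%E.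
Proof. by apply: semidirect_setT; exact: init_law_setT. Qed.

Lemma measurable_move_law phi th B : measurable B ->
  measurable_fun setT (fun z => move_law phi th z B).
Proof.
move=> mB; apply: measurable_fun_integral_signed.
by apply: measurable_fun_xsection_finite_kernel; rewrite inE.
Qed.

Lemma move_law_setT phi th z : move_law phi th z setT = 1%E.
Proof. by apply: semidirect_setT; exact: prob_kernel. Qed.

Lemma measurable_preimage_step t B : measurable B -> measurable (step M t @^-1` B).
Proof. by move=> mB; exact: measurable_funPTI. Qed.

Lemma step_law0 phi th B : measurable B -> step_law phi th 0 B = init_law phi B.
Proof.
move=> mB; rewrite step_lawE -[in RHS](setIT B) -integral_indic//.
apply: eq_integral => z _; have [+ _] := trajP M phi th z.
by move=> /(_ _ mB) ->; rewrite /= diracE indicE.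
Qed.

(** The Markov property with an unconstrained past, every [C i] being [setT], averaged over the
    starting pair. *)
Lemma step_lawS phi th t B : measurable B ->
  step_law phi th t.+1 B = (\int[step_law phi th t]_z move_law phi th z B)%E.
Proof.
move=> mB; rewrite step_lawE.
pose kap z : {measure set (S * A) -> \bar R} :=
  image_measure (traj M phi th z) (measurable_funPT (step M t)).
have mkap C : measurable C -> measurable_fun setT (fun z => kap z C).
  by move=> mC; apply: measurable_kernel; exact: measurable_preimage_step.
have kapE C : measurable C ->
    step_law phi th t C = (\int[init_law phi]_z kap z C)%E.
  by move=> mC; rewrite step_lawE.
rewrite (ge0_integral_mixture mkap kapE)//; last exact: measurable_move_law.
apply: eq_integral => z _; rewrite ge0_integral_pushforward//; last first.
  exact: measurable_move_law.
have [_ /(_ t (fun=> setT) B)] := trajP M phi th z.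
rewrite /= (_ : \bigcap_(i < t.+1) _ = setT); last first.
  by apply/seteqP; split.
by rewrite setTI => ->.
Qed.

Hypotheses
  (policy_cont : forall z phi,
    pol_dens M phi' z @[phi' --> phi] --> pol_dens M phi z)
  (trans_cont : forall z s' th,
    trans_dens M th' z s' @[th' --> th] --> trans_dens M th z s').

Section convergence.
Variables (phi_ : nat -> 'rV[R]_m) (phi : 'rV[R]_m)
  (th_ : nat -> 'rV[R]_n) (th : 'rV[R]_n).
Hypotheses (phi_cvg : phi_ k @[k --> \oo] --> phi)
  (th_cvg : th_ k @[k --> \oo] --> th).

Lemma tv_cvg_policy s : tv_cvg (fun k => policy M (phi_ k) s) (policy M phi s).
Proof.
apply: (@tv_cvg_density _ _ _ (actm M) (fun k a => pol_dens M (phi_ k) (s, a))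
  (fun a => pol_dens M phi (s, a))).
- by move=> k; exact: (measurableT_comp (pol_dens_meas M (phi_ k))
    (pair1_measurable s)).
- exact: (measurableT_comp (pol_dens_meas M phi) (pair1_measurable s)).
- by move=> k a; exact: pol_dens_ge0.
- by move=> a; exact: pol_dens_ge0.
- by move=> k B mB; exact: policyE.
- by move=> B mB; exact: policyE.
- by move=> k; exact: prob_kernel.
- exact: prob_kernel.
- by move=> a; exact: (cvg_comp _ _ phi_cvg (@policy_cont (s, a) phi)).
Qed.

Lemma tv_cvg_trans z : tv_cvg (fun k => trans M (th_ k) z) (trans M th z).
Proof.
apply: (@tv_cvg_density _ _ _ (statem M) (fun k => trans_dens M (th_ k) z)
  (trans_dens M th z)).
- by move=> k; exact: (measurableT_comp (trans_dens_meas M (th_ k))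
    (pair1_measurable z)).
- exact: (measurableT_comp (trans_dens_meas M th) (pair1_measurable z)).
- by move=> k a; exact: trans_dens_ge0.
- by move=> a; exact: trans_dens_ge0.
- by move=> k B mB; exact: transE.
- by move=> B mB; exact: transE.
- by move=> k; exact: prob_kernel.
- exact: prob_kernel.
- by move=> a; exact: (cvg_comp _ _ th_cvg (@trans_cont z a th)).
Qed.

Lemma tv_cvg_init_law : tv_cvg (fun k => init_law (phi_ k)) (init_law phi).
Proof.
apply: tv_cvg_semidirect; [exact: probability_setT|exact: tv_cvg_cst|].
exact: tv_cvg_policy.
Qed.

Lemma tv_cvg_move_law z :
  tv_cvg (fun k => move_law (phi_ k) (th_ k) z) (move_law phi th z).
Proof.
by apply: tv_cvg_semidirect;
  [exact: prob_kernel|exact: tv_cvg_trans|exact: tv_cvg_policy].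
Qed.

Lemma tv_cvg_step_law t :
  tv_cvg (fun k => step_law (phi_ k) (th_ k) t) (step_law phi th t).
Proof.
elim: t => [|t IH].
  apply: (@tv_cvg_ext _ _ _ _ (fun k => init_law (phi_ k)) _ (init_law phi)).
  - by move=> k B mB; exact: step_law0.
  - by move=> B mB; exact: step_law0.
  - exact: tv_cvg_init_law.
apply: (@tv_cvg_mixture _ _ _ _ _ (fun k => step_law (phi_ k) (th_ k) t)
  (step_law phi th t) (fun k => move_law (phi_ k) (th_ k)) (move_law phi th)).
- by move=> k B mB; exact: measurable_move_law.
- by move=> B mB; exact: measurable_move_law.
- by move=> k B mB; exact: step_lawS.
- by move=> B mB; exact: step_lawS.
- by move=> k z; exact: move_law_setT.
- by move=> z; exact: move_law_setT.
- exact: step_law_setT.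
- exact: IH.
- exact: tv_cvg_move_law.
Qed.

Lemma state_law_image phi' th' t B :
  state_law M phi' th' t B = image_measure (step_law phi' th' t) measurable_fst B.
Proof. by symmetry; exact: (step_lawE phi' th' t (fst @^-1` B)). Qed.

Lemma state_law_setT phi' th' t : state_law M phi' th' t setT = 1%E.
Proof. by rewrite state_law_image; exact: step_law_setT. Qed.

Lemma tv_cvg_state_law t :
  tv_cvg (fun k => state_law M (phi_ k) (th_ k) t) (state_law M phi th t).
Proof.
apply: (@tv_cvg_ext _ _ _ _
  (fun k => image_measure (step_law (phi_ k) (th_ k) t) measurable_fst) _
  (image_measure (step_law phi th t) measurable_fst)).
- by move=> k B mB; exact: state_law_image.
- by move=> B mB; exact: state_law_image.
- by apply: tv_cvg_image; exact: tv_cvg_step_law.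
Qed.

(** With the normalizing factor absorbed the weights sum to 1, and [discounted_state] is a convex
    combination of the laws of s_t. *)
Definition geometric_weight t : R := (1 - discount M) * discount M ^+ t.

Lemma geometric_weight_ge0 t : 0 <= geometric_weight t.
Proof.
have := discount_gt0 M; have := discount_lt1 M => g1 g0.
by rewrite mulr_ge0 ?exprn_ge0 ?subr_ge0// ltW.
Qed.

Lemma geometric_weight_sum : (\sum_(t <oo) (geometric_weight t)%:E = 1)%E.
Proof.
have g1 : `|discount M| < 1.
  by rewrite ger0_norm ?discount_lt1// ltW// discount_gt0.
have := @cvg_geometric_series R (1 - discount M) _ g1.
rewrite divff; last by rewrite subr_eq0 eq_sym lt_eqF// discount_lt1.
move=> H; apply/cvg_lim => //.
have -> : (fun k => (\sum_(0 <= t < k) (geometric_weight t)%:E)%E) =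
    EFin \o series (geometric (1 - discount M) (discount M)).
  by apply/funext => k; rewrite /= /series /= sumEFin.
by apply: cvg_EFin => //; exact: nearW.
Qed.

Lemma geometric_weight_integrable :
  counting.-integrable setT (EFin \o geometric_weight).
Proof.
apply/integrableP; split; first by [].
under eq_integral do rewrite /= ger0_norm ?geometric_weight_ge0//.
rewrite ge0_integral_count ?geometric_weight_sum ?ltry// => t.
by rewrite lee_fin geometric_weight_ge0.
Qed.

Lemma discounted_state_series phi' th' B : measurable B ->
  discounted_state M phi' th' B =
  (\sum_(t <oo) (geometric_weight t)%:E * state_law M phi' th' t B)%E.
Proof.
move=> mB; rewrite /discounted_state -nneseriesZl.
  by apply: eq_eseriesr => t _; rewrite EFinM muleA.
move=> t _; rewrite mule_ge0 ?measure_ge0// lee_fin exprn_ge0// ltW//.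
exact: discount_gt0.
Qed.

Lemma discounted_state_setT phi' th' : discounted_state M phi' th' setT = 1%E.
Proof.
rewrite discounted_state_series//.
under eq_eseriesr do rewrite state_law_setT mule1.
exact: geometric_weight_sum.
Qed.

Lemma tv_cvg_discounted_state :
  tv_cvg (fun k => discounted_state M (phi_ k) (th_ k)) (discounted_state M phi th).
Proof.
apply: (@tv_cvg_series _ _ _ geometric_weight
  (fun k => state_law M (phi_ k) (th_ k)) (state_law M phi th)).
- exact: geometric_weight_ge0.
- exact: geometric_weight_integrable.
- by move=> k B mB; exact: discounted_state_series.
- by move=> B mB; exact: discounted_state_series.
- by move=> k t; exact: state_law_setT.
- exact: state_law_setT.
- exact: tv_cvg_state_law.
Qed.

Lemma sampling_setT phi' th' : sampling M phi' th' setT = 1%E.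
Proof. exact: semidirect_setT (discounted_state_setT _ _). Qed.

Lemma tv_cvg_sampling :
  tv_cvg (fun k => sampling M (phi_ k) (th_ k)) (sampling M phi th).
Proof.
apply: tv_cvg_semidirect.
- exact: discounted_state_setT.
- exact: tv_cvg_discounted_state.
- exact: tv_cvg_policy.
Qed.

End convergence.

Lemma measurable_critic phi th : measurable_fun setT (critic M phi th).
Proof.
apply: measurableT_comp; first exact: fine_measurable.
apply: measurable_fun_integral_signed; apply: measurable_fun_limn => k.
apply: emeasurable_sum => t; apply/measurable_EFinP; apply: measurable_funM => //.
by apply: measurableT_comp => //; exact: reward_meas.
Qed.

Lemma measurable_logpi phi : measurable_fun setT (fun z => logpi M z phi).
Proof.
by apply: measurableT_comp; [exact: measurable_ln|exact: pol_dens_meas].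
Qed.

Lemma measurable_score phi i : (forall z, differentiable (logpi M z) phi) ->
  measurable_fun setT (fun z => score M z phi 0 i).
Proof.
move=> dlogpi.
have -> : (fun z => score M z phi 0 i) =
    (fun z => 'D_(delta_mx 0 i) ((fun phi' z' => logpi M z' phi') ^~ z) phi).
  by apply/funext => z; rewrite mxE.
have mlogpi : \forall phi' \near phi, measurable_fun setT (fun z => logpi M z phi').
  by near=> phi'; exact: measurable_logpi.
apply: measurable_derive => [|z]; first exact: mlogpi.
exact/diff_derivable/dlogpi.
Unshelve. all: by end_near. Qed.

End simulation_laws.

(** * Jacobians of the policy gradient *)

Lemma near_pair_left {X Y : topologicalType} (x0 : X) (y0 : Y)
    (P : X -> Y -> Prop) :
  (\forall x \near x0 & y \near y0, P x y) -> \forall x \near x0, P x y0.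
Proof.
move=> [[U V] /= [x0U y0V] UV]; apply: filterS x0U => x Ux.
by apply: (UV (x, y0)); split => //; exact: nbhs_singleton.
Qed.

Lemma near_pair_right {X Y : topologicalType} (x0 : X) (y0 : Y)
    (P : X -> Y -> Prop) :
  (\forall x \near x0 & y \near y0, P x y) -> \forall y \near y0, P x0 y.
Proof.
move=> [[U V] /= [x0U y0V] UV]; apply: filterS y0V => y Vy.
by apply: (UV (x0, y)); split => //; exact: nbhs_singleton.
Qed.

Lemma cvg_pair_left {X Y : topologicalType} (x0 : X) (y0 : Y) :
  (x, y0) @[x --> x0] --> (x0, y0).
Proof. by apply: cvg_pair; [exact: cvg_id|exact: cvg_cst]. Qed.

Lemma cvg_pair_right {X Y : topologicalType} (x0 : X) (y0 : Y) :
  (x0, y) @[y --> y0] --> (x0, y0).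
Proof. by apply: cvg_pair; [exact: cvg_cst|exact: cvg_id]. Qed.

(** Here [g] is recovered as [f - h] from two differentiable functions, so its differentiability is
    a consequence; for the expectation with frozen integrand there is no other access to it. *)
Lemma diff_sub_complement {R : realType} {V W : normedModType R} (f g : V -> W) x
    (L : V -> W) :
  differentiable f x -> differentiable (fun y => f y - g y) x ->
  'd (fun y => f y - g y) x = L :> (V -> W) ->
  forall v, 'd f x v = L v + 'd g x v.
Proof.
set h := fun y => f y - g y; move=> df dh <- v.
have gE : g = f - h by apply/funext => y; rewrite !fctE /h opprB addrC subrK.
by clearbody h; rewrite gE diffB//= addrC subrK.
Qed.

Lemma row_jacobian {R : realType} {p m} (f : 'rV[R]_p -> 'rV[R]_m) x i :
  row i (jacobian f x) = 'd f x (delta_mx 0 i).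
Proof. by rewrite rowE /jacobian mul_rV_lin1. Qed.

Lemma jacobian_sub {R : realType} {p m} (f g : 'rV[R]_p -> 'rV[R]_m) x B :
  differentiable f x -> differentiable (fun y => f y - g y) x ->
  'd (fun y => f y - g y) x = mulmxr B :> ('rV_p -> 'rV_m) ->
  jacobian f x = B + jacobian g x.
Proof.
move=> df dh hE; have E := diff_sub_complement df dh hE.
apply/row_matrixP => i.
have rowD (C : 'M[R]_(p, m)) : row i (B + C) = row i B + row i C.
  by apply/rowP => j; rewrite !mxE.
apply: (etrans (row_jacobian f x i)); apply: (etrans (E _)).
apply: esym; apply: (etrans (rowD _)).
exact: (f_equal2 +%R (rowE i B) (row_jacobian g x i)).
Qed.

Lemma near_forall {X : topologicalType} {I : finType} (x0 : X)
    (P : I -> X -> Prop) :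
  (forall i, \forall x \near x0, P i x) -> \forall x \near x0, forall i, P i x.
Proof. by move=> H; apply: filter_forall. Qed.

Section mexpect_derivative.
Context {R : realType} {d} {T : measurableType d}.

(** [moving_measure_derive] differentiates [Phi - G] entry by entry. Differentiability of [Phi] then
    passes to [G], so the last Jacobian is a genuine derivative. The transposes of [E] reconcile
    [jac] with the right action of matrices on rows. *)
Lemma jac_mexpect {p m} (mu : 'rV[R]_p -> {measure set T -> \bar R})
    (f : 'rV[R]_p -> T -> 'rV[R]_m) (Df : 'rV[R]_p -> T -> 'M[R]_(m, p))
    (x0 : 'rV[R]_p) (w : T -> R) :
  (forall x, mu x setT = 1%E) ->
  (forall u : nat -> 'rV[R]_p, u k @[k --> \oo] --> x0 ->
     tv_cvg (mu \o u) (mu x0)) ->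
  (\forall x \near x0, (mu x).-integrable setT (EFin \o w)) ->
  \int[mu x]_z w z @[x --> x0] --> \int[mu x0]_z w z ->
  (\forall x \near x0, forall i, measurable_fun setT (fun z => f x z 0 i)) ->
  (\forall x \near x0, forall z i, differentiable (fun x' => f x' z 0 i) x) ->
  (\forall x \near x0, forall z i j,
     'D_(delta_mx 0 j) (fun x' => f x' z 0 i) x = Df x z i j) ->
  (\forall x \near x0, forall z, `|f x z| <= w z /\ `|Df x z| <= w z) ->
  differentiable (fun x => mexpect (mu x) (f x)) x0 ->
  jac (fun x => mexpect (mu x) (f x)) x0 =
  mexpect (mu x0) (Df x0) + jac (fun x => mexpect (mu x) (f x0)) x0.
Proof.
move=> mu1 mu_cvg near_iw w_cvg near_mf near_df near_Df near_w dPhi.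
set Phi := fun x => mexpect (mu x) (f x); set G := fun x => mexpect (mu x) (f x0).
pose E := mexpect (mu x0) (Df x0); pose H x := Phi x - G x.
have H_est (e : R) : 0 < e -> \forall x \near x0,
    `|H x - H x0 - mulmxr E^T (x - x0)| <= e * `|x - x0|.
  move=> e0.
  have est i : \forall x \near x0,
      `|\int[mu x]_z f x z 0 i - \int[mu x]_z f x0 z 0 i
        - \sum_j (x - x0) 0 j *
          \int[mu x0]_z 'D_(delta_mx 0 j) (fun x' => f x' z 0 i) x0|
      <= e * `|x - x0|.
    apply: (@moving_measure_derive _ _ _ _ mu (fun x z => f x z 0 i) x0 w) => //.
    - by apply: filterS near_mf => x; exact.
    - by apply: filterS near_df => x Hx z; exact: Hx.
    - apply: filterS near_w => x Hx z; apply: le_trans (Hx z).1.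
      exact: mx_entry_norm.
    - apply: filterS2 near_Df near_w => x DfE Hx z j; rewrite DfE.
      apply: le_trans (Hx z).2; exact: mx_entry_norm.
  have ests : \forall x \near x0, forall i,
      `|\int[mu x]_z f x z 0 i - \int[mu x]_z f x0 z 0 i
        - \sum_j (x - x0) 0 j *
          \int[mu x0]_z 'D_(delta_mx 0 j) (fun x' => f x' z 0 i) x0|
      <= e * `|x - x0| by exact: near_forall.
  apply: filterS ests => x estx.
  apply: row_norm_le => [|i]; first by rewrite mulr_ge0// ltW.
  apply: le_trans (estx i); rewrite le_eqVlt; apply/orP; left; apply/eqP.
  congr (`| _ |); rewrite /H subrr subr0 !mxE; congr (_ - _).
  apply: eq_bigr => j _; rewrite !mxE; congr (_ * _).
  apply: eq_Rintegral => z _; symmetry; exact: (nbhs_singleton near_Df).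
have [dH dHE] := estimate_diff (df := mulmxr E^T) (mulmxr_continuous (B := _)) H_est.
have jE : jacobian Phi x0 = E^T + jacobian G x0 by exact: jacobian_sub.
by rewrite /jac jE linearD /= trmxK.
Qed.

End mexpect_derivative.

Lemma differentiable_entry {R : realType} {p m} (f : 'rV[R]_p -> 'rV[R]_m) x i :
  differentiable f x -> differentiable (fun y => f y 0 i) x.
Proof. by move=> df; exact: (differentiable_comp df (differentiable_coord _ 0 i)). Qed.

Lemma derive_mul {R : realType} {V : normedModType R} (f g : V -> R) x v :
  differentiable f x -> differentiable g x ->
  'D_v (fun y => f y * g y) x = f x * 'D_v g x + g x * 'D_v f x.
Proof. by move=> df dg; apply: deriveM; exact: diff_derivable. Qed.

(** * The two partial Jacobians of the policy gradient *)

Section simulation_jacobians.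
Context {R : realType} {dS dA dW : measure_display} {S : measurableType dS}
  {A : measurableType dA} {W : measurableType dW} {dphi dtheta : nat}.
Variables (M : simulation R S A W dphi dtheta) (phi0 : 'rV[R]_dphi)
  (th0 : 'rV[R]_dtheta) (w : S * A -> R).
Hypotheses
  (policy_C1 : forall z phi,
    continuously_differentiable (fun phi' => pol_dens M phi' z) phi)
  (trans_C1 : forall z s' th,
    continuously_differentiable (fun th' => trans_dens M th' z s') th)
  (logpi_diff2 : \forall phi \near phi0, forall z,
    differentiable (logpi M z) phi /\ differentiable (score M z) phi)
  (dominated : envelope M phi0 th0 w).

Let policy_cont z phi : pol_dens M phi' z @[phi' --> phi] --> pol_dens M phi z.
Proof. exact: (differentiable_continuous (policy_C1 z phi).1). Qed.

Let trans_cont z s' th : trans_dens M th' z s' @[th' --> th] --> trans_dens M th z s'.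
Proof. exact: (differentiable_continuous (trans_C1 z s' th).1). Qed.

Lemma jac_phihat_phi :
  (\forall phi \near phi0, forall z,
     differentiable (fun phi' => critic M phi' th0 z) phi) ->
  differentiable (phihat M ^~ th0) phi0 ->
  jac (phihat M ^~ th0) phi0 =
  mexpect (sampling M phi0 th0) (integrand_dphi M phi0 th0) + Dphi M phi0 th0.
Proof.
move=> dcritic dphihat; have [mw phi_w _ iw w_cont] := dominated.
apply: (@jac_mexpect _ _ _ _ _ (fun phi => sampling M phi th0)
  (fun phi z => critic M phi th0 z *: score M z phi)
  (fun phi => integrand_dphi M phi th0) phi0 w) => //.
- by move=> phi; exact: sampling_setT.
- move=> u uphi; apply: (tv_cvg_sampling policy_cont trans_cont uphi).
  exact: cvg_cst.
- exact: near_pair_left iw.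
- have pair_cvg : (phi, th0) @[phi --> phi0] --> (phi0, th0).
    exact: cvg_pair_left.
  exact: (cvg_comp _ _ pair_cvg w_cont).
- apply: filterS logpi_diff2 => phi dphi_ i.
  under eq_fun do rewrite mxE.
  apply: measurable_funM; first exact: measurable_critic.
  by apply: measurable_score => z; have [] := dphi_ z.
- apply: filterS2 logpi_diff2 dcritic => phi dphi_ dcr z i.
  have -> : (fun phi' => (critic M phi' th0 z *: score M z phi') 0 i) =
      (fun phi' => critic M phi' th0 z * score M z phi' 0 i).
    by apply/funext => phi'; rewrite mxE.
  apply: differentiableM; first exact: dcr.
  by apply: differentiable_entry; have [] := dphi_ z.
- apply: filterS2 logpi_diff2 dcritic => phi dphi_ dcr z i j.
  have -> : (fun phi' => (critic M phi' th0 z *: score M z phi') 0 i) =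
      (fun phi' => critic M phi' th0 z * score M z phi' 0 i).
    by apply/funext => phi'; rewrite mxE.
  rewrite derive_mul; last 2 first.
  - exact: dcr.
  - by apply: differentiable_entry; have [] := dphi_ z.
  (* The outer product is a matrix product over an index set of size one, so its entry is the single
     product that the product rule yields. *)
  by rewrite !mxE big_ord1 !mxE.
Qed.

(** The score does not depend on theta, so the product rule leaves only the derivative of the
    critic. *)
Lemma jac_phihat_theta :
  (\forall th \near th0, forall z,
     differentiable (fun th' => critic M phi0 th' z) th) ->
  differentiable (phihat M phi0) th0 ->
  jac (phihat M phi0) th0 =
  mexpect (sampling M phi0 th0) (integrand_dtheta M phi0 th0) + Dtheta M phi0 th0.
Proof.
move=> dcritic dphihat; have [mw _ th_w iw w_cont] := dominated.
apply: (@jac_mexpect _ _ _ _ _ (fun th => sampling M phi0 th)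
  (fun th z => critic M phi0 th z *: score M z phi0)
  (fun th => integrand_dtheta M phi0 th) th0 w) => //.
- by move=> th; exact: sampling_setT.
- move=> u uth; apply: (tv_cvg_sampling policy_cont trans_cont _ uth).
  exact: cvg_cst.
- exact: near_pair_right iw.
- have pair_cvg : (phi0, th) @[th --> th0] --> (phi0, th0).
    exact: cvg_pair_right.
  exact: (cvg_comp _ _ pair_cvg w_cont).
- near=> th => i; under eq_fun do rewrite mxE.
  apply: measurable_funM; first exact: measurable_critic.
  apply: measurable_score => z.
  by have [] := nbhs_singleton logpi_diff2 z.
- apply: filterS dcritic => th dcr z i.
  have -> : (fun th' => (critic M phi0 th' z *: score M z phi0) 0 i) =
      (fun th' => critic M phi0 th' z * score M z phi0 0 i).
    by apply/funext => th'; rewrite mxE.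
  by apply: differentiableM; [exact: dcr|exact: differentiable_cst].
- apply: filterS dcritic => th dcr z i j.
  have -> : (fun th' => (critic M phi0 th' z *: score M z phi0) 0 i) =
      (fun th' => critic M phi0 th' z * cst (score M z phi0 0 i) th').
    by apply/funext => th'; rewrite mxE.
  rewrite derive_mul; last 2 first.
  - exact: dcr.
  - exact: differentiable_cst.
  by rewrite derive_cst mulr0 add0r !mxE big_ord1 !mxE.
Unshelve. all: by end_near. Qed.

End simulation_jacobians.

(** [defined_implicitly] constrains [g] only near [th0], so the formula is claimed for every such
    [g]; existence is stated separately so that the claim is not vacuous. *)
Theorem theorem1 (R : realType) (dS dA dW : measure_display)
    (S : measurableType dS) (A : measurableType dA) (W : measurableType dW)
    (dphi dtheta : nat) (M : simulation R S A W dphi dtheta)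
    (phi0 : 'rV[R]_dphi) (th0 : 'rV[R]_dtheta) (w : S * A -> R)
    (policy_C1 : forall z phi,
      continuously_differentiable (fun phi' => pol_dens M phi' z) phi)
    (trans_C1 : forall z s' th,
      continuously_differentiable (fun th' => trans_dens M th' z s') th)
    (reward_C1 : forall z th,
      continuously_differentiable (fun th' => reward M th' z) th)
    (* the gradients and the Hessian in the formula exist *)
    (logpi_diff2 : \forall phi \near phi0, forall z,
      differentiable (logpi M z) phi /\ differentiable (score M z) phi)
    (critic_diff_phi : \forall phi \near phi0, forall z,
      differentiable (fun phi' => critic M phi' th0 z) phi)
    (critic_diff_theta : \forall th \near th0, forall z,
      differentiable (fun th' => critic M phi0 th' z) th)
    (* the expectations exist and can be differentiated under the integral *)
    (dominated : envelope M phi0 th0 w)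
    (stationary : phihat M phi0 th0 = 0)
    (phihat_C1 : \forall p \near (phi0, th0),
      continuously_differentiable
        (fun p' : 'rV[R]_dphi * 'rV[R]_dtheta => phihat M p'.1 p'.2) p)
    (isolated : \forall phi \near phi0, phihat M phi th0 = 0 -> phi = phi0)
    (nonsingular : jac (fun phi => phihat M phi th0) phi0 \in unitmx) :
  let Jphi := mexpect (sampling M phi0 th0) (integrand_dphi M phi0 th0)
              + Dphi M phi0 th0 in
  let Jtheta := mexpect (sampling M phi0 th0) (integrand_dtheta M phi0 th0)
                + Dtheta M phi0 th0 in
  [/\ Jphi \in unitmx,
      exists g, defined_implicitly (phihat M) phi0 th0 g
    & forall g, defined_implicitly (phihat M) phi0 th0 g ->
        differentiable g th0 /\ jac g th0 = - (invmx Jphi *m Jtheta) ].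
Proof.
move=> Jphi Jtheta.
have dphihat : differentiable
    (fun p : 'rV[R]_dphi * 'rV[R]_dtheta => phihat M p.1 p.2) (phi0, th0).
  by have [] := nbhs_singleton phihat_C1.
have JphiE : jac (phihat M ^~ th0) phi0 = Jphi.
  apply: (jac_phihat_phi policy_C1 trans_C1 logpi_diff2 dominated critic_diff_phi).
  exact: (diff_partial1 dphihat).1.
have JthetaE : jac (phihat M phi0) th0 = Jtheta.
  apply: (jac_phihat_theta policy_C1 trans_C1 logpi_diff2 dominated critic_diff_theta).
  exact: (diff_partial2 dphihat).1.
have Jphi_unit : Jphi \in unitmx by rewrite -JphiE.
have strict := C1_strictly_differentiable_pair phihat_C1.
have Junit : jacobian (phihat M ^~ th0) phi0 \in unitmx by rewrite -unitmx_tr.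
split=> //; first exact: (implicit_exists strict Junit stationary).
move=> g /(implicit_diff strict Junit stationary)[dg gE]; split=> //.
(* Transposing [K *m invmx J] reverses the factors and gives the inverse on the left, as in the
   formula. *)
by rewrite /jac gE linearN /= trmx_mul trmx_inv -JphiE -JthetaE.
Qed.
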